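(* Let $E$ be a Banach lattice, $X$ a metric space and $1 \le p \le \infty$. A Lipschitz map $T : X \to E$ is Lipschitz $p$-convex if and only if there exist a $p$-convex Banach lattice $W$, a positive operator $\psi : W \to E$ (which may in fact be taken to be an injective interval preserving lattice homomorphism) and a Lipschitz map $R : X \to W$ such that $T = \psi \circ R$. Moreover, in this case $$M^{(p)}_{\mathrm{Lip}}(T) = \inf \ \mathrm{Lip}(R) \cdot M^{(p)}(I_W) \cdot \|\psi\|,$$ where the infimum is taken over all such factorizations.
   Context: $\mathrm{Lip}(\cdot)$ denotes the Lipschitz constant and $I_W$ the identity map of $W$. Banach lattices are real; expressions $(\sum_j |v_j|^p)^{1/p}$ in a Banach lattice are defined by the Krivine functional calculus. A linear map $S : Z \to E$ from a Banach space $Z$ to a Banach lattice $E$ is $p$-convex if there is $M<\infty$ such that for all $n$ and $v_1,\dots,v_n\in Z$, $\big\|(\sum_{j=1}^n |Sv_j|^p)^{1/p}\big\|_E \le M (\sum_{j=1}^n \|v_j\|^p)^{1/p}$ if $p<\infty$, or $\big\|\bigvee_{j=1}^n |Sv_j|\big\|_E \le M\max_{j}\|v_j\|$ if $p=\infty$. The smallest such $M$ is $M^{(p)}(S)$. A Banach lattice $W$ is $p$-convex if $I_W:W\to W$ is $p$-convex. A Lipschitz map $T : X\to E$ from a metric space $(X,d)$ to a Banach lattice $E$ is Lipschitz $p$-convex if there is $C\ge 0$ such that for all $n$, all $x_j,x_j'\in X$ and $\lambda_j\ge 0$ ($1\le j\le n$), $\big\|(\sum_{j=1}^n \lambda_j|Tx_j-Tx_j'|^p)^{1/p}\big\|_E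 \le C(\sum_{j=1}^n \lambda_j d(x_j,x_j')^p)^{1/p}$ if $p<\infty$, or $\big\|\bigvee_{j=1}^n \lambda_j|Tx_j-Tx_j'|\big\|_E\le C\max_j \lambda_j d(x_j,x_j')$ if $p=\infty$. The smallest such $C$ is $M^{(p)}_{\mathrm{Lip}}(T)$. A positive operator $\psi:W\to E$ is interval preserving if $\psi([0,w])=[0,\psi(w)]$ for every $w\ge 0$ in $W$. *)

(* Defs.v *)
From HB Require Import structures.
From mathcomp Require Import all_boot all_order all_algebra.
From mathcomp Require Import all_classical all_reals all_analysis.

Set Implicit Arguments.
Unset Strict Implicit.
Unset Printing Implicit Defensive.

Import Order.TTheory GRing.Theory Num.Theory.
Import numFieldNormedType.Exports.

Local Open Scope classical_set_scope.
Local Open Scope ring_scope.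

(* The order is a field rather than inherited from Order.Lattice because
   Hierarchy Builder cannot join ordered types with normed modules once the
   numeric structures, which inherit from both, have been declared.
   In [`|x|] the bars always denote the norm; the lattice absolute value is
   [vabs] below. *)
HB.mixin Record isBanachLattice (R : realType) E
    & CompleteNormedModule R E := {
  vle : E -> E -> Prop ;
  vjoin : E -> E -> E ;
  vmeet : E -> E -> E ;
  vle_refl : forall x, vle x x ;
  vle_anti : forall x y, vle x y -> vle y x -> x = y ;
  vle_trans : forall y x z, vle x y -> vle y z -> vle x z ;
  vle_joinl : forall x y, vle x (vjoin x y) ;
  vle_joinr : forall x y, vle y (vjoin x y) ;
  vjoin_le : forall x y z, vle x z -> vle y z -> vle (vjoin x y) z ;
  vmeet_lel : forall x y, vle (vmeet x y) x ;
  vmeet_ler : forall x y, vle (vmeet x y) y ;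
  vle_meet : forall x y z, vle z x -> vle z y -> vle z (vmeet x y) ;
  vle_add : forall x y z, vle x y -> vle (x + z) (y + z) ;
  vle_scale : forall (a : R) x y, 0 <= a -> vle x y -> vle (a *: x) (a *: y) ;
  vnorm_mono : forall x y,
    vle (vjoin x (- x)) (vjoin y (- y)) -> `|x| <= `|y|
}.

#[short(type="banachLatticeType")]
HB.structure Definition BanachLattice (R : realType) :=
  {E of CompleteNormedModule R E & isBanachLattice R E}.

Definition vabs (R : realType) (E : banachLatticeType R) (x : E) : E :=
  vjoin x (- x).

(* Supremum of a finite family of positive vectors; as they are positive, the
   unit 0 only matters for the empty family. *)
Definition vsup (R : realType) (E : banachLatticeType R) (n : nat)
    (x : 'I_n -> E) : E :=
  \big[vjoin/0]_(j < n) x j.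

(* The space H_n of continuous positively homogeneous functions on R^n. *)
Definition homog_cont (R : realType) (n : nat) : set ('rV[R]_n -> R) :=
  [set f : 'rV[R]_n -> R | continuous f /\
    forall (a : R) (t : 'rV[R]_n), 0 <= a -> f (a *: t) = a * f t].

(* [tau], restricted to H_n, is a linear lattice homomorphism sending the j-th
   coordinate function to [x j]; its values outside H_n are irrelevant. *)
Definition is_krivine (R : realType) (E : banachLatticeType R) (n : nat)
    (x : 'I_n -> E) (tau : ('rV[R]_n -> R) -> E) : Prop :=
  [/\ forall j, tau (fun t => t ord0 j) = x j,
      forall a f g, homog_cont f -> homog_cont g ->
        tau (fun t => a * f t + g t) = a *: tau f + tau g,
      forall f g, homog_cont f -> homog_cont g ->
        tau (fun t => Num.max (f t) (g t)) = vjoin (tau f) (tau g)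
    & forall f g, homog_cont f -> homog_cont g ->
        tau (fun t => Num.min (f t) (g t)) = vmeet (tau f) (tau g)].

(* Krivine's theorem says that such a [tau] exists and is unique on H_n, so
   [krivine x h] is the vector h(x_1, ..., x_n) for every h in H_n. *)
Definition krivine (R : realType) (E : banachLatticeType R) (n : nat)
    (x : 'I_n -> E) : ('rV[R]_n -> R) -> E :=
  xget (fun=> 0) [set tau | is_krivine x tau].

(* Below, exponents p range over the extended reals with 1 <= p, so the case
   p = -oo is never used.  The least constant satisfying a family of
   inequalities is taken as the infimum of the nonnegative constants that
   satisfy them; the infimum is attained as soon as one such constant exists. *)

Definition pconvex_bound (R : realType) (Z : completeNormedModType R)
    (E : banachLatticeType R) (p : \bar R) (S : {linear Z -> E}) : set R :=
  [set M | 0 <= M /\ forall (n : nat) (v : 'I_n -> Z),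
    match p return Prop with
    | r%:E =>
        `|krivine (fun j => S (v j))
            (fun t => (\sum_(j < n) `|t ord0 j| `^ r) `^ r^-1)|
        <= M * (\sum_(j < n) `|v j| `^ r) `^ r^-1
    | +oo%E =>
        `|vsup (fun j => vabs (S (v j)))| <= M * \big[Num.max/0]_(j < n) `|v j|
    | -oo%E => False
    end].

Definition pconvex (R : realType) (Z : completeNormedModType R)
    (E : banachLatticeType R) (p : \bar R) (S : {linear Z -> E}) : Prop :=
  exists M, pconvex_bound p S M.

Definition pconvex_const (R : realType) (Z : completeNormedModType R)
    (E : banachLatticeType R) (p : \bar R) (S : {linear Z -> E}) : R :=
  inf (pconvex_bound p S).

Definition idmap (R : realType) (W : banachLatticeType R) : {linear W -> W} :=
  idfun.

Definition pconvex_lattice (R : realType) (p : \bar R)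
    (W : banachLatticeType R) : Prop :=
  pconvex p (idmap W).

Definition lip_bound (R : realType) (X : metricType R) (E : normedModType R)
    (f : X -> E) : set R :=
  [set L | 0 <= L /\ forall x y, `|f x - f y| <= L * mdist x y].

Definition lipschitz_map (R : realType) (X : metricType R)
    (E : normedModType R) (f : X -> E) : Prop :=
  exists L, lip_bound f L.

Definition lip_const (R : realType) (X : metricType R) (E : normedModType R)
    (f : X -> E) : R :=
  inf (lip_bound f).

Definition lip_pconvex_bound (R : realType) (X : metricType R)
    (E : banachLatticeType R) (p : \bar R) (T : X -> E) : set R :=
  [set C | 0 <= C /\
    forall (n : nat) (x x' : 'I_n -> X) (lam : 'I_n -> R),
    (forall j, 0 <= lam j) ->
    match p return Prop with
    | r%:E =>
        `|krivine (fun j => T (x j) - T (x' j))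
            (fun t => (\sum_(j < n) lam j * `|t ord0 j| `^ r) `^ r^-1)|
        <= C * (\sum_(j < n) lam j * mdist (x j) (x' j) `^ r) `^ r^-1
    | +oo%E =>
        `|vsup (fun j => lam j *: vabs (T (x j) - T (x' j)))|
        <= C * \big[Num.max/0]_(j < n) (lam j * mdist (x j) (x' j))
    | -oo%E => False
    end].

Definition lip_pconvex (R : realType) (X : metricType R)
    (E : banachLatticeType R) (p : \bar R) (T : X -> E) : Prop :=
  exists C, lip_pconvex_bound p T C.

Definition lip_pconvex_const (R : realType) (X : metricType R)
    (E : banachLatticeType R) (p : \bar R) (T : X -> E) : R :=
  inf (lip_pconvex_bound p T).

(* Positive linear maps between Banach lattices are automatically bounded, so
   the supremum in [opnorm] is that of a nonempty bounded set. *)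
Definition positive_op (R : realType) (W E : banachLatticeType R)
    (psi : {linear W -> E}) : Prop :=
  forall w : W, vle 0 w -> vle 0 (psi w).

Definition opnorm (R : realType) (W E : normedModType R)
    (psi : {linear W -> E}) : R :=
  sup [set `|psi w| | w in [set w : W | `|w| <= 1]].

Definition lattice_hom (R : realType) (W E : banachLatticeType R)
    (psi : {linear W -> E}) : Prop :=
  {morph psi : x y / vjoin x y} /\ {morph psi : x y / vmeet x y}.

Definition vinterval (R : realType) (E : banachLatticeType R) (a b : E) : set E :=
  [set x | vle a x /\ vle x b].

Definition interval_preserving (R : realType) (W E : banachLatticeType R)
    (psi : {linear W -> E}) : Prop :=
  positive_op psi /\
  forall w : W, vle 0 w -> psi @` vinterval 0 w = vinterval 0 (psi w).

Definition pconvex_factorization (R : realType) (X : metricType R)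
    (E W : banachLatticeType R) (p : \bar R) (T : X -> E)
    (psi : {linear W -> E}) (rho : X -> W) : Prop :=
  [/\ pconvex_lattice p W, positive_op psi, lipschitz_map rho
    & T = psi \o rho].

(* Main.v *)
From HB Require Import structures.
Require Import Defs.
From mathcomp Require Import all_boot all_order all_algebra.
From mathcomp Require Import all_classical all_reals all_analysis.
From mathcomp Require Import finmap ring lra.
Import Order.TTheory GRing.Theory Num.Theory.
Import numFieldNormedType.Exports.
Set Implicit Arguments.
Unset Strict Implicit.
Unset Printing Implicit Defensive.
Local Open Scope classical_set_scope.
Local Open Scope ring_scope.

(* For a Lipschitz p-convex map [T] with constant [C], let [B] be the closure of
   the set of vectors [y] with [|y| <= (sum_j |c_j a_j| ^ p) ^ (1 / p)], where
   [c] is in the unit ball of the finite-dimensional l_p space and the [a_j] are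
   slopes [(T x - T x') / d(x, x')], perturbed by multiples of a small vector
   proportional to one value of [T].  This set is solid, convex and p-convex,
   and Lipschitz p-convexity says that it is contained in a ball of [E] of radius
   close to [C]; its gauge norm therefore turns its span into a p-convex Banach
   lattice with constant 1, an ideal of [E] through which [T] factors.
   Conversely, [(sum_j |x_j| ^ p) ^ (1 / p)] is the least upper bound of the
   combinations [sum_j b_j x_j] with [b] in the dual unit ball, so a positive
   operator [psi] satisfies
   [(sum_j |psi w_j| ^ p) ^ (1 / p) <= psi ((sum_j |w_j| ^ p) ^ (1 / p))].
   Both directions use the Krivine calculus, whose existence and uniqueness are
   obtained from the density of the differences of finite maxima of linear forms
   and from the fact that a linear form below such a maximum is a convex
   combination of its members, which transfers inequalities from R^n to [E]. *)

(** * Banach lattices *)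

(** Each demand on the gauge of [B] rests on its own device. Convexity of a set defined by p-sums is
    not immediate: a probability vector is written as a product [b * s] with [b] in the dual unit
    ball and [s] of p-norm 1, and rescaling by [b] puts the modulus of a sum of two vectors below a
    p-sum. p-convexity with constant exactly 1 comes from concatenating representing families, since
    l_p norms associate over blocks. Completeness requires the gauge balls to be closed in [E],
    hence the closure; solidity must then be recovered by truncation. As the slopes lie in [B], the
    map into the new lattice has Lipschitz constant at most 1, and the only loss is the size of the
    perturbation in the norm of the inclusion. This gives products at most [C + e] for every
    [e > 0], which is enough for an infimum. Finite and infinite exponents share one norm [pnorm],
    handled mostly through norming functionals. *)

Arguments vle_trans {R s} y {x z} _ _.
Arguments vle_add {R s} {x y} z _.
Arguments vle_scale {R s} a {x y} _ _.
Arguments vle_anti {R s} {x y} _ _.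
Arguments vle_refl {R s x}.
Arguments vjoin_le {R s x y z} _ _.
Arguments vle_meet {R s x y z} _ _.
Arguments vnorm_mono {R s x y} _.

Section vector_lattice.
Context {R : realType} {E : banachLatticeType R}.
Implicit Types (x y z u v w : E) (a : R).

Lemma vle_lerD x y u v : vle x y -> vle u v -> vle (x + u) (y + v).
Proof.
move=> xy uv; apply: (vle_trans (y + u)); first exact: vle_add.
by rewrite ![y + _]addrC; exact: vle_add.
Qed.

Lemma vle_addrR x y z : vle (x + z) y <-> vle x (y - z).
Proof.
by split=> [/(vle_add (- z))|/(vle_add z)]; rewrite ?addrK ?subrK.
Qed.

Lemma vle_subr0 x y : vle x y <-> vle 0 (y - x).
Proof. by rewrite -vle_addrR add0r. Qed.

Lemma vle_subrR x y z : vle (x - z) y <-> vle x (y + z).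
Proof. by rewrite vle_addrR opprK. Qed.

Lemma vle_opp x y : vle x y -> vle (- y) (- x).
Proof. by rewrite (vle_subr0 x) (vle_subr0 (- y)) opprK addrC. Qed.

Lemma vle_oppl x y : vle (- x) y -> vle (- y) x.
Proof. by move/vle_opp; rewrite opprK. Qed.

Lemma vjoinP x y z : vle (vjoin x y) z <-> vle x z /\ vle y z.
Proof.
split=> [h|[? ?]]; last exact: vjoin_le.
by split; apply: (vle_trans (vjoin x y) _ h); [exact: vle_joinl|exact: vle_joinr].
Qed.

(** Identities between joins reduce to equivalences between their upper bounds, which [vjoinP] makes
    propositional. *)
Lemma vle_ext x y : (forall z, vle x z <-> vle y z) -> x = y.
Proof. by move=> h; apply: vle_anti; apply/h; exact: vle_refl. Qed.

Lemma vjoinC x y : vjoin x y = vjoin y x.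
Proof. by apply: vle_ext => z; rewrite !vjoinP; tauto. Qed.

Lemma vjoin_addr x y z : vjoin (x + z) (y + z) = vjoin x y + z.
Proof. by apply: vle_ext => w; rewrite vle_addrR !vjoinP !vle_addrR. Qed.

Lemma vjoin_r x y : vle x y -> vjoin x y = y.
Proof.
by move=> xy; apply: vle_anti; [apply/vjoinP; split=> //; exact: vle_refl|exact: vle_joinr].
Qed.

Lemma vscale_le a x y : 0 < a -> vle (a *: x) y <-> vle x (a^-1 *: y).
Proof.
move=> a0; split=> [/(vle_scale a^-1)|/(vle_scale a)].
  by rewrite scalerA mulVf ?gt_eqF// scale1r; apply; rewrite invr_ge0 ltW.
by rewrite scalerA mulfV ?gt_eqF// scale1r; apply; rewrite ltW.
Qed.

Lemma vjoin_scale a x y : 0 <= a -> vjoin (a *: x) (a *: y) = a *: vjoin x y.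
Proof.
rewrite le_eqVlt => /predU1P[<-|a0].
  by rewrite !scale0r vjoin_r//; exact: vle_refl.
by apply: vle_ext => z; rewrite vscale_le// !vjoinP !vscale_le.
Qed.

Lemma vmeetE x y : vmeet x y = - vjoin (- x) (- y).
Proof.
apply: vle_anti.
  rewrite -[X in vle X]opprK; apply: vle_opp; apply/vjoinP.
  by split; apply: vle_opp; [exact: vmeet_lel|exact: vmeet_ler].
by apply: vle_meet; apply: vle_oppl; [exact: vle_joinl|exact: vle_joinr].
Qed.

Lemma vle_abs x : vle x (vabs x). Proof. exact: vle_joinl. Qed.

Lemma vle_absN x : vle (- x) (vabs x). Proof. exact: vle_joinr. Qed.

Lemma vabs_leP x z : vle (vabs x) z <-> vle x z /\ vle (- x) z.
Proof. exact: vjoinP. Qed.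

Lemma vabsN x : vabs (- x) = vabs x.
Proof. by rewrite /vabs opprK vjoinC. Qed.

(** Adding [x <= |x|] and [- x <= |x|] gives [0 <= 2 |x|]. *)
Lemma vabs_ge0 x : vle 0 (vabs x).
Proof.
have := vle_lerD (vle_abs x) (vle_absN x).
rewrite subrr -[X in X + X]scale1r -scalerDl => /(vle_scale 2^-1).
by rewrite scaler0 scalerA mulVf ?scale1r//; apply; rewrite invr_ge0.
Qed.

Lemma ge0_vabs x : vle 0 x -> vabs x = x.
Proof.
move=> x0; rewrite /vabs vjoinC vjoin_r//; apply: (vle_trans 0) => //.
by apply: vle_oppl; rewrite oppr0.
Qed.

Lemma vabs_id x : vabs (vabs x) = vabs x.
Proof. by rewrite ge0_vabs//; exact: vabs_ge0. Qed.

Lemma vabs0 : vabs (0 : E) = 0.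
Proof. by rewrite ge0_vabs//; exact: vle_refl. Qed.

Lemma vabsZ a x : vabs (a *: x) = `|a| *: vabs x.
Proof.
wlog a0 : a x / 0 <= a => [hw|].
  have [/hw//|/ltW a0] := leP 0 a.
  by rewrite -vabsN -scaleNr hw ?oppr_ge0// normrN.
by rewrite ger0_norm// /vabs -scalerN vjoin_scale.
Qed.

Lemma vabsD x y : vle (vabs (x + y)) (vabs x + vabs y).
Proof.
apply/vabs_leP; rewrite opprD; split; apply: vle_lerD;
  (exact: vle_abs || exact: vle_absN).
Qed.

Lemma vnorm_le x y : vle (vabs x) (vabs y) -> `|x| <= `|y|.
Proof. exact: vnorm_mono. Qed.

Lemma vnorm_abs x : `|vabs x| = `|x|.
Proof.
by apply/eqP; rewrite eq_le; apply/andP; split; apply: vnorm_le; rewrite vabs_id;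
  exact: vle_refl.
Qed.

Lemma vabs_le_norm x y : vle (vabs x) y -> `|x| <= `|y|.
Proof. by move=> h; apply: vnorm_le; apply: (vle_trans y h); exact: vle_abs. Qed.

Lemma vle_norm x y : vle 0 x -> vle x y -> `|x| <= `|y|.
Proof. by move=> x0 xy; apply: vabs_le_norm; rewrite ge0_vabs. Qed.

(** Makes the join norm continuous, which carries it through limits in [approx_max]. By symmetry one
    of the two inequalities behind the modulus is enough. *)
Lemma vabs_joinB x y x' y' :
  vle (vabs (vjoin x y - vjoin x' y')) (vabs (x - x') + vabs (y - y')).
Proof.
suff h : forall x y x' y' : E,
    vle (vjoin x y - vjoin x' y') (vabs (x - x') + vabs (y - y')).
  apply/vabs_leP; split => //; rewrite opprB.
  by rewrite -(vabsN (x - x')) -(vabsN (y - y')) !opprB.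
move=> {}x {}y {}x' {}y'; rewrite vle_addrR opprK; apply/vjoinP; split.
  rewrite -[X in vle X](subrK x') -[X in vle _ X]addrA; apply: vle_lerD; first exact: vle_abs.
  rewrite -[X in vle X]add0r; apply: vle_lerD; first exact: vabs_ge0.
  exact: vle_joinl.
rewrite -[X in vle X](subrK y') [X in vle _ (X + _)]addrC -[X in vle _ X]addrA.
apply: vle_lerD; first exact: vle_abs.
rewrite -[X in vle X]add0r; apply: vle_lerD; first exact: vabs_ge0.
exact: vle_joinr.
Qed.

(** The order is norm closed: the positive part [d] of [x - y] lies below the modulus of every
    admissible error [w], so its norm is below every [e]. *)
Lemma vle_closed x y :
  (forall e : R, 0 < e -> exists2 w, `|w| <= e & vle x (y + w)) -> vle x y.
Proof.
move=> h; pose d := vjoin (x - y) 0.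
suff d0 : `|d| <= 0.
  have := vle_joinl (x - y) 0; rewrite -/d; move: d0; rewrite normr_le0 => /eqP ->.
  by rewrite vle_addrR sub0r opprK.
apply/ler_addgt0Pl => e e0; rewrite addr0; have [w we xyw] := h _ e0.
apply: le_trans we; rewrite -(vnorm_abs w); apply: vle_norm; first exact: vle_joinr.
apply/vjoinP; split; last exact: vabs_ge0.
by rewrite vle_addrR opprK; apply: (vle_trans (y + w) xyw); rewrite addrC;
  apply: vle_add; exact: vle_abs.
Qed.

Lemma vle_sum (I : Type) (s : seq I) (P : pred I) (f g : I -> E) :
  (forall i, P i -> vle (f i) (g i)) ->
  vle (\sum_(i <- s | P i) f i) (\sum_(i <- s | P i) g i).
Proof.
move=> fg; apply: (big_ind2 vle) => //; first exact: vle_refl.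
by move=> *; exact: vle_lerD.
Qed.

Lemma vabs_sum (I : Type) (s : seq I) (P : pred I) (f : I -> E) :
  vle (vabs (\sum_(i <- s | P i) f i)) (\sum_(i <- s | P i) vabs (f i)).
Proof.
apply: (big_ind2 (fun u v => vle (vabs u) v)).
- by rewrite vabs0; exact: vle_refl.
- move=> u v u' v' uv uv'; apply: (vle_trans (vabs u + vabs u')).
    exact: vabsD.
  exact: vle_lerD.
- by move=> *; exact: vle_refl.
Qed.

Lemma vscale_ge0 a x : 0 <= a -> vle 0 x -> vle 0 (a *: x).
Proof. by move=> a0 /(vle_scale a a0); rewrite scaler0. Qed.

Lemma vle_scaler a b x : a <= b -> vle 0 x -> vle (a *: x) (b *: x).
Proof.
by move=> ab x0; rewrite vle_subr0 -scalerBl; apply: vscale_ge0; rewrite ?subr_ge0.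
Qed.
End vector_lattice.

(** * Separation from a finite convex hull *)

Section real_sums.
Context {R : realType}.

Lemma continuous_sumr (T : topologicalType) (I : Type) (s : seq I) (P : pred I)
    (F : I -> T -> R) :
  (forall i, P i -> continuous (F i)) ->
  continuous (fun t => \sum_(i <- s | P i) F i t).
Proof. by apply: continuous_big; exact: add_continuous. Qed.

Variable n : nat.
Implicit Types (a b t : 'rV[R]_n) (s : seq 'rV[R]_n) (f g : 'rV[R]_n -> R).

Definition dotv a t : R := \sum_j a ord0 j * t ord0 j.

Lemma dotvDl a b t : dotv (a + b) t = dotv a t + dotv b t.
Proof. by rewrite -big_split; apply: eq_bigr => j _; rewrite mxE mulrDl. Qed.

Lemma dotvZl (c : R) a t : dotv (c *: a) t = c * dotv a t.
Proof. by rewrite mulr_sumr; apply: eq_bigr => j _; rewrite mxE mulrA. Qed.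

Lemma dotvC a t : dotv a t = dotv t a.
Proof. by apply: eq_bigr => j _; rewrite mulrC. Qed.

Lemma dotvDr a b t : dotv t (a + b) = dotv t a + dotv t b.
Proof. by rewrite dotvC dotvDl !(dotvC t). Qed.

Lemma dotvZr (c : R) a t : dotv a (c *: t) = c * dotv a t.
Proof. by rewrite dotvC dotvZl dotvC. Qed.

Lemma dotv_delta j t : dotv (delta_mx ord0 j) t = t ord0 j.
Proof.
rewrite /dotv (bigD1 j)//= mxE !eqxx mul1r big1 ?addr0// => i ij.
by rewrite mxE (negbTE ij) mul0r.
Qed.

Lemma dotv_sqB (e : R) a b :
  dotv (a - e *: b) (a - e *: b) = dotv a a - 2 * e * dotv b a + e ^+ 2 * dotv b b.
Proof. by rewrite -scaleNr !(dotvDl, dotvDr, dotvZl, dotvZr) (dotvC b a); ring. Qed.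

Lemma dotvv_ge0 t : 0 <= dotv t t.
Proof. by apply: sumr_ge0 => j _; rewrite -expr2 sqr_ge0. Qed.

Lemma dotvv_eq0 t : dotv t t = 0 -> t = 0.
Proof.
move=> /eqP; rewrite psumr_eq0 => [/allP h|j _]; last by rewrite -expr2 sqr_ge0.
apply/rowP => j; have /implyP/(_ isT) := h j (mem_index_enum _).
by rewrite mulf_eq0 orbb mxE => /eqP.
Qed.

Lemma continuous_dotv a : continuous (dotv a).
Proof.
apply: continuous_sumr => j _ t; apply: continuousM; first exact: cst_continuous.
exact: coord_continuous.
Qed.

(* Minimise the distance from [a] to the convex hull of [s]. *)
Lemma mem_conv s a : (forall t, exists2 b, b \in s & dotv a t <= dotv b t) ->
  exists c : 'I_(size s) -> R,
    [/\ forall i, 0 <= c i, \sum_i c i = 1 & a = \sum_i c i *: s`_i].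
Proof.
set k := size s => dom.
pose D := [set c : 'rV[R]_k | (forall i, 0 <= c ord0 i) /\ \sum_i c ord0 i = 1].
pose d (c : 'rV[R]_k) := a - \sum_(i < k) c ord0 i *: s`_i.
have k0 : (0 < k)%N.
  by have [b + _] := dom 0; rewrite /k; case: (s).
have D0 : D !=set0.
  exists (delta_mx ord0 (Ordinal k0)); split=> [i|]; first by rewrite mxE ler0n.
  rewrite (bigD1 (Ordinal k0))//= mxE !eqxx big1 ?addr0// => i ij.
  by rewrite mxE (negbTE ij).
have Dcompact : compact D.
  apply: bounded_closed_compact.
    exists 1; split; first exact: num_real.
    move=> M M1 c [c0 c1]; rewrite /Num.Def.normr/= mx_normrE.
    apply/bigmax_leP; split; first by rewrite (le_trans ler01)// ltW.
    move=> [i j] _ /=; rewrite ord1 ger0_norm//.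
    apply: le_trans (ltW M1); rewrite -c1 (bigD1 j)//= lerDl.
    by apply: sumr_ge0.
  rewrite (_ : D = (\bigcap_(i in [set: 'I_k])
      ((fun c : 'rV[R]_k => c ord0 i) @^-1` [set x | 0 <= x])) `&`
      ((fun c : 'rV[R]_k => \sum_i c ord0 i) @^-1` [set 1])); last first.
    by apply/seteqP; split=> [c [h1 h2]|c [h1 h2]]; split=> // i; [move=> _|]; exact: h1.
  apply: closedI.
    apply: closed_bigI => i _; apply: closed_comp; last exact: closed_ge.
    by move=> x _; exact: coord_continuous.
  apply: closed_comp; last exact: closed_eq.
  by move=> x _; apply: continuous_sumr => i _; exact: coord_continuous.
have dE c j : d c ord0 j = a ord0 j - \sum_(i < k) c ord0 i * s`_i ord0 j.
  by rewrite !mxE summxE; congr (_ - _); apply: eq_bigr => i _; rewrite mxE.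
have dcont : continuous (fun c => dotv (d c) (d c)).
  apply: continuous_sumr => j _ c.
  suff h : {for c, continuous (fun c => d c ord0 j)} by apply: continuousM.
  rewrite (_ : (fun c => d c ord0 j) = (fun c : 'rV[R]_k => a ord0 j - \sum_(i < k) c ord0 i * s`_i ord0 j)).
    apply: continuousB; first exact: cst_continuous.
    apply: continuous_sumr => i _ {}c; apply: continuousM; last exact: cst_continuous.
    exact: coord_continuous.
  by apply/funext => c'.
have [c /set_mem[c0 c1] cmin] :=
  EVT_min_rV D0 Dcompact (continuous_subspaceT dcont).
exists (fun i => c ord0 i); split=> //; apply/eqP; rewrite -subr_eq0; apply/eqP.
rewrite -[X in X = _]/(d c); apply: dotvv_eq0.
(* The domination hypothesis is tested at the residual [d c] itself; the member of [s] that it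
   returns is the direction in which the distance would decrease. *)
have [b /(nthP 0)[i ik <-] hb] := dom (d c); set b' := s`_i in hb.
pose q := b' - \sum_(i < k) c ord0 i *: s`_i.
have qd : dotv (d c) (d c) <= dotv q (d c).
  by rewrite {1}/d /q !dotvDl lerD2r.
(* Minimality of [c] against the point at parameter [e] of the segment from [c] to the vertex of
   index [i]. *)
have key e : 0 <= e <= 1 ->
    2 * e * dotv (d c) (d c) <= e ^+ 2 * dotv q q.
  move=> /andP[e0 e1].
  pose c' := c + e *: (delta_mx ord0 (Ordinal ik) - c).
  have : D c'.
    split=> [j|].
      rewrite !mxE (_ : _ + _ = (1 - e) * c ord0 j +
          e * ((ord0 == ord0 :> 'I_1) && (j == Ordinal ik))%:R); last by ring.
      by rewrite addr_ge0// mulr_ge0// subr_ge0.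
    rewrite (eq_bigr (fun j => (1 - e) * c ord0 j + e * (j == Ordinal ik)%:R)).
      rewrite big_split/= -!mulr_sumr c1 (bigD1 (Ordinal ik))//= eqxx big1 => [|j /negbTE ->//].
      by rewrite /= mulr1 addr0 mulr1 subrK.
    by move=> j _; rewrite !mxE eqxx/=; set z := _%:R; ring.
  move=> Dc'; have := cmin c' (mem_set Dc').
  have -> : d c' = d c - e *: q.
    apply/rowP => j; rewrite dE !mxE summxE.
    rewrite (eq_bigr (fun l => (1 - e) * (c ord0 l * s`_l ord0 j)
        + e * ((l == Ordinal ik)%:R * s`_l ord0 j))); last first.
      by move=> l _; rewrite !mxE eqxx/=; ring.
    have sel : \sum_(l < k) (l == Ordinal ik)%:R * s`_l ord0 j = b' ord0 j.
      rewrite (bigD1 (Ordinal ik))//= eqxx mul1r big1 ?addr0// => l /negbTE lk.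
      by rewrite lk mul0r.
    rewrite big_split/= -!mulr_sumr sel.
    under [in RHS]eq_bigr do rewrite mxE.
    by set S := \sum_(i < k) _; ring.
  rewrite dotv_sqB; have := ler_wpM2l e0 qd; nra.
apply/eqP; rewrite eq_le dotvv_ge0 andbT leNgt; apply/negP => A0.
set A := dotv (d c) (d c) in key A0.
have Q0 : 0 <= dotv q q := dotvv_ge0 q.
(* For this [e] the product [e * dotv q q] is below [A], whereas [key] would make it at least
   [2 * A]. *)
pose e := A / (A + dotv q q).
have AQ : 0 < A + dotv q q by lra.
have /key : 0 <= e <= 1.
  by rewrite divr_ge0 ?(ltW A0) ?(ltW AQ)//= ler_pdivrMr// mul1r lerDl.
have e0 : 0 < e by rewrite divr_gt0.
have eE : e * (A + dotv q q) = A by rewrite /e mulfVK// gt_eqF.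
set Q := dotv q q in Q0 AQ eE *.
nra.
Qed.

End real_sums.

(** * Positively homogeneous continuous functions *)

Section homogeneous.
Context {R : realType}.

Lemma continuous_row (T : topologicalType) (n : nat) (f : 'I_n -> T -> R) :
  (forall i, continuous (f i)) ->
  continuous (fun t => \row_i f i t : 'rV[R]_n).
Proof.
move=> fc t A [P MP sPA].
have : nbhs t (\bigcap_(i in [set` [fset i | i in 'I_n]%fset])
    (f i @^-1` (P ord0 i))).
  apply: filter_bigI => i _; apply: fc; have := MP ord0 i.
  by rewrite mxE.
apply: filterS => u hu; apply: sPA => i j; rewrite mxE ord1; apply: hu.
by rewrite /= inE.
Qed.

Variable n : nat.
Implicit Types (a t : 'rV[R]_n) (f g : 'rV[R]_n -> R).

Lemma homog_cont0 f : homog_cont f -> f 0 = 0.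
Proof. by move=> [_ /(_ 0 0 (lexx _))]; rewrite scaler0 mul0r. Qed.

Lemma eq_homog_cont f g : f =1 g -> homog_cont f -> homog_cont g.
Proof. by move=> /funext ->. Qed.

Lemma homog_cont_dotv a : homog_cont (dotv a).
Proof.
by split=> [|c t _]; [exact: continuous_dotv|rewrite dotvZr].
Qed.

Lemma homog_cont_coord j : homog_cont (fun t => t ord0 j).
Proof. by split=> [|c t _]; [exact: coord_continuous|rewrite mxE]. Qed.

Lemma homog_cont_comb (c : R) f g : homog_cont f -> homog_cont g ->
  homog_cont (fun t => c * f t + g t).
Proof.
move=> [fc fh] [gc gh]; split=> [|b t b0]; last by rewrite fh// gh//; ring.
move=> t; apply: (@continuousD R R^o 'rV[R]_n (fun t => c * f t) g t); last exact: gc.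
by apply: (@continuousM R 'rV[R]_n (fun=> c) f t); [exact: cst_continuous|exact: fc].
Qed.

Lemma homog_cont_max f g : homog_cont f -> homog_cont g ->
  homog_cont (fun t => Num.max (f t) (g t)).
Proof.
move=> [fc fh] [gc gh]; split=> [|b t b0]; last by rewrite fh// gh// maxr_pMr.
by move=> t; apply: continuous_max; [exact: fc|exact: gc].
Qed.

Lemma homog_cont_abs f : homog_cont f -> homog_cont (fun t => `|f t|).
Proof.
move=> [fc fh]; split=> [|b t b0]; last by rewrite fh// normrM ger0_norm.
by move=> t; apply: continuous_comp; [exact: fc|exact: norm_continuous].
Qed.

Lemma homog_cont_sum (I : Type) (s : seq I) (P : pred I) (F : I -> 'rV[R]_n -> R) :
  (forall i, homog_cont (F i)) ->
  homog_cont (fun t => \sum_(i <- s | P i) F i t).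
Proof.
move=> Fh; split=> [|b t b0].
  by apply: continuous_sumr => i _; exact: (Fh i).1.
by rewrite mulr_sumr; apply: eq_bigr => i _; rewrite (Fh i).2.
Qed.

Lemma homog_cont_scale (c : R) f : homog_cont f -> homog_cont (fun t => c * f t).
Proof.
move=> [fc fh]; split=> [|b t b0]; last by rewrite fh// mulrCA.
by move=> t; apply: (@continuousM R 'rV[R]_n (fun=> c) f t); [exact: cst_continuous|exact: fc].
Qed.

Lemma homog_cont_comp m (h : 'rV[R]_m -> R) (F : 'I_m -> 'rV[R]_n -> R) :
  homog_cont h -> (forall i, homog_cont (F i)) ->
  homog_cont (fun t => h (\row_i F i t)).
Proof.
move=> [hc hh] Fh; split=> [|b t b0].
  move=> t; apply: continuous_comp; last exact: hc.
  by apply: continuous_row => i; exact: (Fh i).1.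
rewrite -hh//; congr h; apply/rowP => i; rewrite !mxE.
by rewrite (Fh i).2.
Qed.

(** Errors are measured in this norm because it is a lattice expression in the coordinates: its
    value at the vectors [x j] is [vl1norm], so an error bound on R^n becomes one in [E]. *)
Definition l1norm t : R := \sum_j `|t ord0 j|.

Lemma homog_cont_l1norm : homog_cont l1norm.
Proof.
by apply: homog_cont_sum => j; apply: homog_cont_abs; exact: homog_cont_coord.
Qed.

Lemma l1norm_ge0 t : 0 <= l1norm t. Proof. exact: sumr_ge0. Qed.

Lemma le_l1norm t j : `|t ord0 j| <= l1norm t.
Proof. by rewrite /l1norm (bigD1 j)//= lerDl sumr_ge0. Qed.

Lemma l1norm_eq0 t : l1norm t = 0 -> t = 0.
Proof.
move=> h; apply/rowP => j; apply/eqP; rewrite mxE -normr_le0 -h; exact: le_l1norm.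
Qed.

Lemma norm_le_l1norm t : `|t| <= l1norm t.
Proof.
rewrite [leLHS]/Num.Def.normr/= mx_normrE; apply/bigmax_leP; split.
  exact: l1norm_ge0.
by move=> [i j] _ /=; rewrite ord1; exact: le_l1norm.
Qed.

Definition sphere : set 'rV[R]_n := [set t | l1norm t = 1].

Lemma sphere_compact : compact sphere.
Proof.
apply: bounded_closed_compact.
  exists 1; split; first exact: num_real.
  by move=> M M1 t St; apply: le_trans (ltW M1); rewrite -St; exact: norm_le_l1norm.
apply: (@closed_comp _ _ l1norm [set 1]); last exact: closed_eq.
by move=> t _; exact: homog_cont_l1norm.1.
Qed.

Lemma homog_cont_le_sphere f g : homog_cont f -> homog_cont g ->
  (forall t, sphere t -> f t <= g t) -> forall t, f t <= g t.
Proof.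
move=> fh gh fg t; have [/l1norm_eq0 ->|t0] := eqVneq (l1norm t) 0.
  by rewrite !homog_cont0.
have tp : 0 < l1norm t by rewrite lt_neqAle eq_sym t0 l1norm_ge0.
set u := (l1norm t)^-1 *: t; have -> : t = l1norm t *: u.
  by rewrite /u scalerA mulfV// scale1r.
rewrite (fh.2 _ _ (ltW tp)) (gh.2 _ _ (ltW tp)) ler_pM2l//; apply: fg.
by rewrite /sphere/= homog_cont_l1norm.2 ?invr_ge0 ?l1norm_ge0// mulVf.
Qed.

Lemma homog_cont_bound f : homog_cont f ->
  exists2 B, 0 <= B & forall t, `|f t| <= B * l1norm t.
Proof.
move=> fh.
have : bounded_set (f @` sphere).
  apply: (@compact_bounded R R^o); apply: (@continuous_compact 'rV[R]_n R^o).
    by apply: continuous_subspaceT; exact: fh.1.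
  exact: sphere_compact.
move=> /ex_strict_bound_gt0[B B0 hB]; exists B; first exact: ltW.
apply: homog_cont_le_sphere; first exact: homog_cont_abs.
  by apply: homog_cont_scale; exact: homog_cont_l1norm.
by move=> t St; rewrite St mulr1 ltW//; apply: hB; exists t.
Qed.

(* By compactness of the sphere, finitely many of the given minorants suffice. *)
Lemma max_cover (P : set ('rV[R]_n -> R)) f (e : R) :
  0 < e -> homog_cont f -> P `<=` @homog_cont R n ->
  (forall g h, P g -> P h -> P (fun t => Num.max (g t) (h t))) ->
  (exists2 g, P g & forall t, g t <= f t + e * l1norm t) ->
  (forall s, sphere s -> exists2 g,
     P g & (forall t, g t <= f t + e * l1norm t) /\ f s - e < g s) ->
  exists2 g, P g & forall t, `|f t - g t| <= e * l1norm t.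
Proof.
move=> e0 fh Ph Pmax [g0 Pg0 g0f] cov.
have /choice[G GP] : forall s, exists g, sphere s ->
    [/\ P g, forall t, g t <= f t + e * l1norm t & f s - e < g s].
  move=> s; have [Ss|nS] := pselect (sphere s); last by exists (fun=> 0).
  by have [g Pg [? ?]] := cov s Ss; exists g.
have := sphere_compact; rewrite compact_cover => /(_ 'rV[R]_n sphere
   (fun s => [set t | 0 < G s t - (f t - e * l1norm t)])).
case=> [s Ss|s Ss|D' D'S Dcov].
- apply: (@open_comp _ _ (fun t => G s t - (f t - e * l1norm t)) [set x | 0 < x]);
    last exact: open_gt.
  have [PG _ _] := GP _ Ss; move=> t _.
  apply: (@continuousB R R^o 'rV[R]_n (G s)); first exact: (Ph _ PG).1.
  apply: (@continuousB R R^o 'rV[R]_n f (fun t => e * l1norm t)); first exact: fh.1.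
  exact: (homog_cont_scale e homog_cont_l1norm).1.
- exists s => //=; have [_ _] := GP _ Ss.
  by rewrite Ss mulr1 subr_gt0.
(* The maximum starts from [g0], so that it makes sense for an empty cover; the sphere is empty when
   [n = 0]. *)
have [g Pg [gle gge]] : exists2 g, P g &
    (forall t, g t <= f t + e * l1norm t) /\
    forall t s, s \in (D' : seq _) -> G s t <= g t.
  have : forall s, s \in (D' : seq _) -> sphere s.
    by move=> s sD; apply/set_mem; exact: D'S.
  elim: (D' : seq _) => [|s r IH] hr; first by exists g0.
  have [|g Pg [h1 h2]] := IH; first by move=> u ur; apply: hr; rewrite inE ur orbT.
  have [PG hG _] := GP s (hr s (mem_head _ _)).
  exists (fun t => Num.max (G s t) (g t)); first exact: Pmax.
  split=> [t|t u]; first by rewrite ge_max hG h1.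
  by rewrite inE le_max => /orP[/eqP ->|/h2->]; rewrite ?lexx ?orbT.
exists g => //; apply: homog_cont_le_sphere.
- apply: homog_cont_abs; apply: eq_homog_cont (homog_cont_comb (-1) (Ph _ Pg) fh).
  by move=> t; rewrite mulN1r addrC.
- by apply: homog_cont_scale; exact: homog_cont_l1norm.
- move=> t St; have [s sD /= hs] := Dcov t St.
  have := gle t; have := gge t s sD; move: hs; rewrite St !mulr1 ler_norml.
  by move=> ? ? ?; apply/andP; split; lra.
Qed.

End homogeneous.

(** * Krivine functional calculus *)

Section finite_maxima.
Context {R : realType} (n : nat).
Implicit Types (a t : 'rV[R]_n) (s : seq 'rV[R]_n) (f g : 'rV[R]_n -> R).

(** Described by upper bounds, exactly as [join_of] describes joins in [E], so that the same
    arguments serve on both sides. *)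
Definition max_of s f := forall t z,
  f t <= z <-> forall a, a \in s -> dotv a t <= z.

Lemma max_of1 a : max_of [:: a] (dotv a).
Proof.
by move=> t z; split=> [h b|h]; [rewrite inE => /eqP ->|apply: h; rewrite inE].
Qed.

Lemma max_of_cat s s' f f' : max_of s f -> max_of s' f' ->
  max_of (s ++ s') (fun t => Num.max (f t) (f' t)).
Proof.
move=> sf sf' t z; rewrite ge_max; split=> [/andP[/sf h /sf' h'] a|h].
  by rewrite mem_cat => /orP[/h|/h'].
by apply/andP; split; [apply/sf|apply/sf'] => a sa; apply: h; rewrite mem_cat sa ?orbT.
Qed.

Lemma max_of_add s s' f f' : max_of s f -> max_of s' f' ->
  max_of [seq a + b | a <- s, b <- s'] (fun t => f t + f' t).
Proof.
move=> sf sf' t z; split=> [h _ /allpairsP[[a b] /= [sa sb ->]]|h].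
  rewrite dotvDl; apply: le_trans h; apply: lerD.
    by have /sf : f t <= f t by []; apply.
  by have /sf' : f' t <= f' t by []; apply.
rewrite -lerBrDr; apply/sf => a sa; rewrite lerBrDr addrC -lerBrDr.
by apply/sf' => b sb; rewrite lerBrDr addrC -dotvDl; apply: h; exact: allpairs_f.
Qed.

Lemma max_of_scale s f (c : R) : 0 < c -> max_of s f ->
  max_of [seq c *: a | a <- s] (fun t => c * f t).
Proof.
move=> c0 sf t z; rewrite -ler_pdivlMl// sf; split=> h a.
  by move=> /mapP[b sb ->]; rewrite dotvZl -ler_pdivlMl//; exact: h.
by move=> sa; rewrite ler_pdivlMl// -dotvZl; apply: h; exact: map_f.
Qed.

Lemma max_of_ext s f g : max_of s f -> max_of s g -> f = g.
Proof.
move=> sf sg; apply/funext => t; apply/eqP; rewrite eq_le; apply/andP; split.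
  by apply/sf; apply/sg.
by apply/sg; apply/sf.
Qed.

Lemma max_of_ex s : s != [::] -> exists2 f, max_of s f & homog_cont f.
Proof.
elim: s => // a [|b s] IH _.
  by exists (dotv a); [exact: max_of1|exact: homog_cont_dotv].
have [//|f sf fh] := IH; exists (fun t => Num.max (dotv a t) (f t)).
  exact: max_of_cat (max_of1 a) sf.
by apply: homog_cont_max => //; exact: homog_cont_dotv.
Qed.

Lemma max_of_homog s f : s != [::] -> max_of s f -> homog_cont f.
Proof. by move=> /max_of_ex[g sg gh] sf; rewrite (max_of_ext sf sg). Qed.

Lemma max_of_dom s f a : s != [::] -> max_of s f -> (forall t, dotv a t <= f t) ->
  forall t, exists2 b, b \in s & dotv a t <= dotv b t.
Proof.
move=> s0 sf af t; apply/not_exists2P => h.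
suff : f t < f t by rewrite ltxx.
apply: lt_le_trans (af t); rewrite ltNge; apply/negP => aft.
have {h} h b : b \in s -> dotv b t < dotv a t.
  by move=> sb; rewrite ltNge; apply/negP => ?; have [] := h b.
(* [max_of] only tests non-strict bounds, so finitely many strict inequalities are first gathered
   under one bound [m]. *)
have : exists2 m, m < dotv a t & forall b, b \in s -> dotv b t <= m.
  elim: (s) h => [|b r IH] h.
    by exists (dotv a t - 1) => //; rewrite ltrBlDr ltrDl.
  have [m mt hm] : exists2 m, m < dotv a t & forall b, b \in r -> dotv b t <= m.
    by apply: IH => c cr; apply: h; rewrite inE cr orbT.
  exists (Num.max m (dotv b t)); first by rewrite gt_max mt h// mem_head.
  by move=> c; rewrite inE le_max => /orP[/eqP->|/hm->//]; rewrite lexx orbT.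
move=> [m mt /(sf t m).2 fm]; by have := le_lt_trans (le_trans aft fm) mt; rewrite ltxx.
Qed.

End finite_maxima.

(** * Existence and uniqueness of the Krivine calculus *)

Section krivine_calculus.
Context {R : realType} {E : banachLatticeType R} (n : nat) (x : 'I_n -> E).
Implicit Types (a t : 'rV[R]_n) (s : seq 'rV[R]_n) (f g : 'rV[R]_n -> R).
Implicit Types (u v z : E).

Definition lin a : E := \sum_j a ord0 j *: x j.

Lemma linD a b : lin (a + b) = lin a + lin b.
Proof. by rewrite -big_split; apply: eq_bigr => j _; rewrite mxE scalerDl. Qed.

Lemma linZ (c : R) a : lin (c *: a) = c *: lin a.
Proof. by rewrite scaler_sumr; apply: eq_bigr => j _; rewrite mxE scalerA. Qed.

Lemma lin_delta j : lin (delta_mx ord0 j) = x j.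
Proof.
rewrite /lin (bigD1 j)//= mxE !eqxx scale1r big1 ?addr0// => i ij.
by rewrite mxE (negbTE ij) scale0r.
Qed.

Definition join_of s u := forall z, vle u z <-> forall a, a \in s -> vle (lin a) z.

Lemma join_of1 a : join_of [:: a] (lin a).
Proof.
by move=> z; split=> [h b|h]; [rewrite inE => /eqP ->|apply: h; rewrite inE].
Qed.

Lemma join_of_cat s s' u u' : join_of s u -> join_of s' u' ->
  join_of (s ++ s') (vjoin u u').
Proof.
move=> su su' z; rewrite vjoinP; split=> [[/su h /su' h'] a|h].
  by rewrite mem_cat => /orP[/h|/h'].
by split; [apply/su|apply/su'] => a sa; apply: h; rewrite mem_cat sa ?orbT.
Qed.

Lemma join_of_add s s' u u' : join_of s u -> join_of s' u' ->
  join_of [seq a + b | a <- s, b <- s'] (u + u').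
Proof.
move=> su su' z; split=> [h _ /allpairsP[[a b] /= [sa sb ->]]|h].
  rewrite linD; apply: (vle_trans (u + u')) => //; apply: vle_lerD.
    by apply: (su u).1 => //; exact: vle_refl.
  by apply: (su' u').1 => //; exact: vle_refl.
rewrite vle_addrR; apply/su => a sa; rewrite -vle_addrR addrC vle_addrR.
by apply/su' => b sb; rewrite -vle_addrR addrC -linD; apply: h; exact: allpairs_f.
Qed.

Lemma join_of_scale s u (c : R) : 0 < c -> join_of s u ->
  join_of [seq c *: a | a <- s] (c *: u).
Proof.
move=> c0 su z; rewrite vscale_le// su; split=> h a.
  by move=> /mapP[b sb ->]; rewrite linZ vscale_le//; exact: h.
by move=> sa; rewrite -vscale_le// -linZ; apply: h; exact: map_f.
Qed.

Lemma join_of_ex s : s != [::] -> exists u, join_of s u.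
Proof.
elim: s => // a [|b s] IH _; first by exists (lin a); exact: join_of1.
have [//|u su] := IH; exists (vjoin (lin a) u).
exact: join_of_cat (join_of1 a) su.
Qed.

(* A linear form dominated by a finite maximum is a convex combination of its
   members, so the comparison carries over to [E]. *)
Lemma join_of_le s s' f f' u u' : s' != [::] -> max_of s f -> join_of s u ->
  max_of s' f' -> join_of s' u' -> (forall t, f t <= f' t) -> vle u u'.
Proof.
move=> s'0 sf su sf' su' ff'; apply/su => a sa.
have /mem_conv[c [c0 c1 ->]] : forall t, exists2 b, b \in s' & dotv a t <= dotv b t.
  apply: (max_of_dom s'0 sf') => t; apply: le_trans (ff' t).
  exact: (sf t (f t)).1.
have -> : lin (\sum_i c i *: s'`_i) = \sum_i c i *: lin s'`_i.
  apply: (big_ind2 (fun a u => lin a = u)) => [|a1 u1 a2 u2 <- <-|i _].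
  - by rewrite /lin big1// => j _; rewrite mxE scale0r.
  - exact: linD.
  - exact: linZ.
rewrite -[u']scale1r -c1 scaler_suml; apply: vle_sum => i _; apply: vle_scale => //.
by apply: (su' u').1; [exact: vle_refl|exact: mem_nth].
Qed.

(** A relation, because the value [u] is read off a representation of [f] as a difference; that it
    depends on [f] alone follows from [pwl_le]. *)
Definition pwl f u := exists s1 s2 f1 f2 u1 u2,
  [/\ s1 != [::] /\ s2 != [::], max_of s1 f1 /\ max_of s2 f2,
      join_of s1 u1 /\ join_of s2 u2, f = (fun t => f1 t - f2 t)
    & u = u1 - u2].

Lemma pwl_dotv a : pwl (dotv a) (lin a).
Proof.
exists [:: a], [:: 0], (dotv a), (dotv 0), (lin a), (lin 0); split=> //.
- by split; exact: max_of1.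
- by split; exact: join_of1.
- apply/funext => t; rewrite [X in _ - X](_ : _ = 0) ?subr0//.
  by rewrite -(scale0r (0 : 'rV[R]_n)) dotvZl mul0r.
- by rewrite -(scale0r (0 : 'rV[R]_n)) linZ scale0r subr0.
Qed.

Lemma allpairs_neq0 (s s' : seq 'rV[R]_n) : s != [::] -> s' != [::] ->
  [seq a + b | a <- s, b <- s'] != [::].
Proof. by case: s => // a s; case: s'. Qed.

Lemma pwl_add f g u v : pwl f u -> pwl g v -> pwl (fun t => f t + g t) (u + v).
Proof.
move=> [s1 [s2 [f1 [f2 [u1 [u2 [[s1n s2n] [sf1 sf2] [su1 su2] -> ->]]]]]]].
move=> [r1 [r2 [g1 [g2 [v1 [v2 [[r1n r2n] [rg1 rg2] [rv1 rv2] -> ->]]]]]]].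
exists [seq a + b | a <- s1, b <- r1], [seq a + b | a <- s2, b <- r2],
  (fun t => f1 t + g1 t), (fun t => f2 t + g2 t), (u1 + v1), (u2 + v2); split.
- by split; exact: allpairs_neq0.
- by split; exact: max_of_add.
- by split; exact: join_of_add.
- by apply/funext => t; ring.
- by rewrite opprD addrACA.
Qed.

Lemma pwl_opp f u : pwl f u -> pwl (fun t => - f t) (- u).
Proof.
move=> [s1 [s2 [f1 [f2 [u1 [u2 [[s1n s2n] [sf1 sf2] [su1 su2] -> ->]]]]]]].
exists s2, s1, f2, f1, u2, u1; split=> //; last by rewrite opprB.
by apply/funext => t; rewrite opprB.
Qed.

Lemma pwl_scale (c : R) f u : pwl f u -> pwl (fun t => c * f t) (c *: u).
Proof.
wlog c0 : c f u / 0 < c => [hw fu|].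
  have [c0|c0|->] := ltgtP c 0; last 2 first.
  - exact: hw.
  - rewrite scale0r (_ : (fun _ => _) = dotv 0).
      rewrite -[X in pwl _ X](scale0r (lin 0)) -linZ scale0r.
      exact: pwl_dotv.
    by apply/funext => t; rewrite -(scale0r (0 : 'rV[R]_n)) dotvZl !mul0r.
  have -> : (fun t => c * f t) = (fun t => - c * - f t).
    by apply/funext => t; rewrite mulrNN.
  by rewrite -[c *: u]opprK -scalerN -scaleNr; apply: hw; [rewrite oppr_gt0|exact: pwl_opp].
move=> [s1 [s2 [f1 [f2 [u1 [u2 [[s1n s2n] [sf1 sf2] [su1 su2] -> ->]]]]]]].
exists [seq c *: a | a <- s1], [seq c *: a | a <- s2], (fun t => c * f1 t),
  (fun t => c * f2 t), (c *: u1), (c *: u2); split.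
- by case: (s1) s1n => //; case: (s2) s2n.
- by split; exact: max_of_scale.
- by split; exact: join_of_scale.
- by apply/funext => t; rewrite mulrBr.
- by rewrite scalerBr.
Qed.

Lemma pwl_comb (c : R) f g u v : pwl f u -> pwl g v ->
  pwl (fun t => c * f t + g t) (c *: u + v).
Proof. by move=> fu gv; apply: pwl_add => //; exact: pwl_scale. Qed.

(** [max (f1 - f2) (g1 - g2) = max (f1 + g2) (g1 + f2) - (f2 + g2)], in R and in [E] alike. *)
Lemma pwl_max f g u v : pwl f u -> pwl g v ->
  pwl (fun t => Num.max (f t) (g t)) (vjoin u v).
Proof.
move=> [s1 [s2 [f1 [f2 [u1 [u2 [[s1n s2n] [sf1 sf2] [su1 su2] -> ->]]]]]]].
move=> [r1 [r2 [g1 [g2 [v1 [v2 [[r1n r2n] [rg1 rg2] [rv1 rv2] -> ->]]]]]]].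
exists ([seq a + b | a <- s1, b <- r2] ++ [seq a + b | a <- r1, b <- s2]),
  [seq a + b | a <- s2, b <- r2],
  (fun t => Num.max (f1 t + g2 t) (g1 t + f2 t)), (fun t => f2 t + g2 t),
  (vjoin (u1 + v2) (v1 + u2)), (u2 + v2); split.
- split; last exact: allpairs_neq0.
  by move: (allpairs_neq0 s1n r2n); case: [seq _ | _ <- s1, _ <- r2].
- by split; [apply: max_of_cat|]; exact: max_of_add.
- by split; [apply: join_of_cat|]; exact: join_of_add.
- by apply/funext => t; rewrite addr_maxl; congr Num.max; ring.
- rewrite -vjoin_addr; congr vjoin; rewrite opprD.
    by rewrite addrACA subrr addr0.
  by rewrite [- u2 + _]addrC addrACA subrr addr0.
Qed.

Lemma pwl_abs f u : pwl f u -> pwl (fun t => `|f t|) (vabs u).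
Proof.
move=> fu; rewrite (_ : (fun _ => _) = (fun t => Num.max (f t) (- f t))).
  by apply: pwl_max => //; exact: pwl_opp.
apply/funext => t; case: (lerP 0 (f t)) => ft; last by rewrite max_r ?ltr0_norm//; lra.
by rewrite max_l ?ger0_norm//; lra.
Qed.

Lemma pwl_sum (I : Type) (r : seq I) (F : I -> 'rV[R]_n -> R) (w : I -> E) :
  (forall i, pwl (F i) (w i)) ->
  pwl (fun t => \sum_(i <- r) F i t) (\sum_(i <- r) w i).
Proof.
move=> Fw; elim: r => [|i r IH].
  have := pwl_scale 0 (pwl_dotv 0); rewrite big_nil scale0r; congr pwl.
  by apply/funext => t; rewrite big_nil mul0r.
rewrite big_cons (_ : (fun _ => _) = (fun t => F i t + \sum_(i <- r) F i t)).
  exact: pwl_add.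
by apply/funext => t; rewrite big_cons.
Qed.

Lemma pwl_coord j : pwl (fun t => t ord0 j) (x j).
Proof.
have := pwl_dotv (delta_mx ord0 j); rewrite lin_delta; congr pwl.
by apply/funext => t; exact: dotv_delta.
Qed.

Definition vl1norm : E := \sum_j vabs (x j).

Lemma pwl_l1norm : pwl (@l1norm R n) vl1norm.
Proof. by apply: pwl_sum => j; apply: pwl_abs; exact: pwl_coord. Qed.

Lemma pwl_homog f u : pwl f u -> homog_cont f.
Proof.
move=> [s1 [s2 [f1 [f2 [u1 [u2 [[s1n s2n] [sf1 sf2] _ -> _]]]]]]].
apply: eq_homog_cont
  (homog_cont_comb (-1) (max_of_homog s2n sf2) (max_of_homog s1n sf1)) => t.
by rewrite mulN1r addrC.
Qed.

(** Moving the subtracted terms across turns this into a comparison of two finite maxima,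
    [f1 + g2 <= g1 + f2]. *)
Lemma pwl_le f g u v : pwl f u -> pwl g v -> (forall t, f t <= g t) -> vle u v.
Proof.
move=> [s1 [s2 [f1 [f2 [u1 [u2 [[s1n s2n] [sf1 sf2] [su1 su2] -> ->]]]]]]].
move=> [r1 [r2 [g1 [g2 [v1 [v2 [[r1n r2n] [rg1 rg2] [rv1 rv2] -> ->]]]]]]] fg.
have h : vle (u1 + v2) (v1 + u2).
  apply: (join_of_le _ (max_of_add sf1 rg2) (join_of_add su1 rv2)
    (max_of_add rg1 sf2) (join_of_add rv1 su2)); first exact: allpairs_neq0.
  by move=> t; have := fg t; lra.
by rewrite -vle_addrR addrAC vle_addrR opprK.
Qed.

(* The building block is a peak [f(s) |t| - A |t - |t| s|] at the point [s]. *)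
Lemma pwl_dense f (e : R) : homog_cont f -> 0 < e ->
  exists g u, pwl g u /\ forall t, `|f t - g t| <= e * l1norm t.
Proof.
move=> fh e0; have [B B0 fB] := homog_cont_bound fh.
pose P := [set g | exists u, pwl g u].
have [||||g [u gu] h] := @max_cover R n P f e e0 fh; last by exists g, u.
- by move=> g [u] /pwl_homog.
- by move=> g h [u gu] [v hv]; exists (vjoin u v); exact: pwl_max.
- exists (fun t => - B * l1norm t); first by exists (- B *: vl1norm); apply: pwl_scale; exact: pwl_l1norm.
  move=> t; have := fB t; rewrite ler_norml => /andP[+ _].
  by have := mulr_ge0 (ltW e0) (l1norm_ge0 t); lra.
move=> s Ss.
have : nbhs s [set t | `|f s - f t| < e].
  by have /(_ s) /(@cvgrPdist_lt _ R^o) h := fh.1; exact: (h e e0).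
move=> /nbhs_ballP[d /= d0 hd].
(* With this slope the peak has dropped by at least [2 * B] at distance [d] from [s], hence below
   [- B], a lower bound of [f] on the sphere. Nearer to [s], continuity of [f] is enough. *)
pose A := 2 * B / d.
pose g t := f s * l1norm t - A * l1norm (t - l1norm t *: s).
have gP : P g.
  exists (- A *: (\sum_j vabs (x j - s ord0 j *: vl1norm)) + f s *: vl1norm).
  rewrite (_ : g = (fun t => - A * (\sum_j `|t ord0 j + - s ord0 j * l1norm t|)
     + f s * l1norm t)).
    apply: pwl_add; apply: pwl_scale; last exact: pwl_l1norm.
    apply: pwl_sum => j; apply: pwl_abs; rewrite -scaleNr; apply: pwl_add.
      exact: pwl_coord.
    by apply: pwl_scale; exact: pwl_l1norm.
  apply/funext => t; rewrite /g /l1norm addrC mulNr; congr (- (_ * _) + _).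
  by apply: eq_bigr => j _; rewrite !mxE mulNr [s _ _ * _]mulrC.
exists g => //; split; last first.
  rewrite /g Ss scale1r subrr (homog_cont0 (homog_cont_l1norm n)); lra.
apply: homog_cont_le_sphere; first by have [u] := gP; exact: pwl_homog.
  by apply: eq_homog_cont (homog_cont_comb e (homog_cont_l1norm n) fh) => t; rewrite addrC.
move=> t St; rewrite /g St scale1r !mulr1.
have fsB := fB s; have ftB := fB t; rewrite Ss St !mulr1 !ler_norml in fsB ftB.
have [ts|ts] := ltP (l1norm (t - s)) d.
  have : `|f s - f t| < e.
    apply: hd; rewrite -ball_normE /= -normrN opprB.
    by apply: le_lt_trans ts; exact: norm_le_l1norm.
  rewrite ltr_norml => /andP[_ h]; have : 0 <= A * l1norm (t - s).
    by rewrite mulr_ge0 ?l1norm_ge0// divr_ge0 ?mulr_ge0// ltW.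
  lra.
have : 2 * B <= A * l1norm (t - s).
  by rewrite /A -mulrA ler_peMr ?mulr_ge0// mulrC ler_pdivlMr// mul1r.
by move: fsB ftB => /andP[? ?] /andP[? ?]; lra.
Qed.

(** The closure of the relation [pwl]; on H_n it is the graph of the calculus. *)
Definition approx f u := forall e : R, 0 < e -> exists g v,
  [/\ pwl g v, forall t, `|f t - g t| <= e * l1norm t & `|u - v| <= e].

Lemma pwl_approx f u : pwl f u -> approx f u.
Proof.
move=> fu e e0; exists f, u; split=> // [t|]; last by rewrite subrr normr0 ltW.
by rewrite subrr normr0 mulr_ge0 ?l1norm_ge0// ltW.
Qed.

Lemma pwl_dist f g u v (e : R) : pwl f u -> pwl g v ->
  (forall t, `|f t - g t| <= e * l1norm t) -> vle (vabs (u - v)) (e *: vl1norm).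
Proof.
move=> fu gv fg; apply: (@pwl_le (fun t => `|f t - g t|) (fun t => e * l1norm t)).
- by apply: pwl_abs; apply: pwl_add => //; exact: pwl_opp.
- by apply: pwl_scale; exact: pwl_l1norm.
- exact: fg.
Qed.

Lemma approx_le f g u v : approx f u -> approx g v ->
  (forall t, f t <= g t) -> vle u v.
Proof.
move=> fu gv fg; apply: vle_closed => e e0.
(* Two norm errors [d] and the lattice error [2 * d *: vl1norm] have to add up to [e]. *)
pose d := e / (2 + 2 * `|vl1norm|).
have N0 : 0 < 2 + 2 * `|vl1norm| by rewrite ltr_wpDr// mulr_ge0.
have d0 : 0 < d by rewrite divr_gt0.
have [f' [u' [fu' ff' uu']]] := fu d d0; have [g' [v' [gv' gg' vv']]] := gv d d0.
exists ((u - u') + (v' - v) + (2 * d) *: vl1norm).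
  apply: le_trans (ler_normD _ _) _; rewrite normrZ gtr0_norm ?mulr_gt0//.
  apply: (@le_trans _ _ (d + d + 2 * d * `|vl1norm|)).
    rewrite lerD2r; apply: le_trans (ler_normD _ _) _; apply: lerD => //.
    by rewrite distrC.
  by rewrite [leLHS](_ : _ = d * (2 + 2 * `|vl1norm|)); [rewrite mulfVK ?gt_eqF|ring].
have : vle u' (v' + (2 * d) *: vl1norm).
  apply: (@pwl_le f' (fun t => g' t + (2 * d) * l1norm t)) => //.
    by apply: pwl_add => //; apply: pwl_scale; exact: pwl_l1norm.
  move=> t; have := ff' t; have := gg' t; have := fg t; rewrite !ler_norml.
  by move=> ? /andP[? ?] /andP[? ?]; lra.
move=> h; have -> : v + (u - u' + (v' - v) + (2 * d) *: vl1norm) =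
    u - u' + (v' + (2 * d) *: vl1norm).
  rewrite -[X in v + X]addrA (addrCA v).  congr (_ + _).  by rewrite addrA addrCA subrr addr0.
by have := vle_add (u - u') h; rewrite addrC subrK [X in vle _ X]addrC.
Qed.

Lemma approx_uniq f u v : approx f u -> approx f v -> u = v.
Proof. by move=> fu fv; apply: vle_anti; apply: (approx_le (f := f) (g := f)). Qed.

Lemma approx_comb (c : R) f g u v : approx f u -> approx g v ->
  approx (fun t => c * f t + g t) (c *: u + v).
Proof.
move=> fu gv e e0; pose d := e / (`|c| + 1).
have c1 : 0 < `|c| + 1 by rewrite ltr_wpDl.
have d0 : 0 < d by rewrite divr_gt0.
have dE : `|c| * d + d = e by rewrite -[X in _ + X]mul1r -mulrDl /d mulrC mulfVK ?gt_eqF.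
have [f' [u' [fu' ff' uu']]] := fu d d0; have [g' [v' [gv' gg' vv']]] := gv d d0.
exists (fun t => c * f' t + g' t), (c *: u' + v'); split; first exact: pwl_comb.
  move=> t; rewrite opprD addrACA -mulrBr -dE mulrDl.
  apply: le_trans (ler_normD _ _) _; apply: lerD => //.
  by rewrite normrM -mulrA ler_wpM2l.
rewrite opprD addrACA -scalerBr -dE.
apply: le_trans (ler_normD _ _) _; apply: lerD => //.
by rewrite normrZ ler_wpM2l.
Qed.

Lemma approx_max f g u v : approx f u -> approx g v ->
  approx (fun t => Num.max (f t) (g t)) (vjoin u v).
Proof.
move=> fu gv e e0; have d0 : 0 < e / 2 by rewrite divr_gt0.
have [f' [u' [fu' ff' uu']]] := fu _ d0; have [g' [v' [gv' gg' vv']]] := gv _ d0.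
exists (fun t => Num.max (f' t) (g' t)), (vjoin u' v'); split; first exact: pwl_max.
  move=> t; have := ff' t; have := gg' t; rewrite !ler_norml.
  have := mulr_ge0 (ltW d0) (l1norm_ge0 t); have -> : e / 2 * l1norm t = e * l1norm t / 2.
    by rewrite mulrAC.
  by rewrite /Num.max/=; do 2 case: ltP => ?; move=> ? /andP[? ?] /andP[? ?]; apply/andP; split; lra.
apply: le_trans (_ : `|vabs (u - u') + vabs (v - v')| <= _).
  apply: vabs_le_norm; exact: vabs_joinB.
apply: le_trans (ler_normD _ _) _; rewrite !vnorm_abs [leRHS](splitr e).
exact: lerD.
Qed.

(** Piecewise linear approximations with errors [1 / (k + 1)] have values that form a Cauchy
    sequence by [pwl_dist]; completeness of [E] gives the limit. *)
Lemma approx_ex f : homog_cont f -> exists u, approx f u.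
Proof.
move=> fh.
have /choice[F /choice[U FU]] : forall k : nat, exists g, exists u, pwl g u /\
    forall t, `|f t - g t| <= k.+1%:R^-1 * l1norm t.
  by move=> k; exact: pwl_dense.
have dU (k m l : nat) : (l <= k)%N -> (l <= m)%N ->
    `|U k - U m| <= 2 * l.+1%:R^-1 * `|vl1norm|.
  move=> lk lm; rewrite -[X in _ <= X * _]ger0_norm ?mulr_ge0 ?invr_ge0// -normrZ.
  apply: vabs_le_norm; apply: (pwl_dist (FU k).1 (FU m).1) => t.
  have inv i : (l <= i)%N -> i.+1%:R^-1 * l1norm t <= l.+1%:R^-1 * l1norm t.
    move=> li; rewrite ler_wpM2r ?l1norm_ge0// lef_pV2 ?posrE ?ltr0n//.
    by rewrite ler_nat ltnS.
  have := le_trans ((FU k).2 t) (inv _ lk); have := le_trans ((FU m).2 t) (inv _ lm).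
  rewrite !ler_norml mulrAC -mulrA; set z := l.+1%:R^-1 * l1norm t.
  have -> : 2 * (l1norm t / l.+1%:R) = 2 * z by rewrite /z; ring.
  by move=> /andP[? ?] /andP[? ?]; apply/andP; split; lra.
have small (e : R) : 0 < e -> exists l : nat, 2 * l.+1%:R^-1 * `|vl1norm| <= e /\
     l.+1%:R^-1 <= e.
  move=> e0; pose M := 1 + 2 * `|vl1norm|.
  have M0 : 0 < M by rewrite ltr_wpDr// mulr_ge0.
  exists (Num.truncn (M / e)); set l := Num.truncn _.
  have hl : M / e < l.+1%:R by rewrite truncnS_gt.
  have l0 : 0 < l.+1%:R :> R by rewrite ltr0n.
  have : M <= e * l.+1%:R by move: (ltW hl); rewrite ler_pdivrMr// mulrC.
  have := normr_ge0 vl1norm; rewrite /M => N0 h; split.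
    by rewrite mulrAC ler_pdivrMr//; lra.
  by rewrite -[_^-1]mul1r ler_pdivrMr//; lra.
have : cvgn U.
  apply/cauchy_cvgP/cauchyP => e e0.
  have [l [hl _]] := small (e / 2) (divr_gt0 e0 (ltr0Sn _ _)).
  exists (U l); exists l => // k /= lk; rewrite -ball_normE /=.
  by apply: le_lt_trans (dU _ _ _ (leqnn l) lk) _; apply: le_lt_trans hl _; lra.
move=> /cvg_ex[u Uu]; exists u => e e0.
have [l [hl hl']] := small e e0.
exists (F l), (U l); split; first exact: (FU l).1.
  move=> t; apply: le_trans ((FU l).2 t) _.
  by rewrite ler_wpM2r ?l1norm_ge0.
rewrite distrC; apply: le_trans hl.
apply: (@closed_cvg _ _ \oo _ (fun k => `|U l - U k|) [set z | z <= 2 * l.+1%:R^-1 * `|vl1norm|]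
   (@closed_le R _) _ `|U l - u|); last first.
  by apply: cvg_norm; apply: cvgB; [exact: cvg_cst|exact: Uu].
by exists l => // k /= lk; exact: dU.
Qed.

Lemma is_krivine_min tau : is_krivine x tau ->
  forall f g, homog_cont f -> homog_cont g -> (forall t, f t <= g t) ->
  vle (tau f) (tau g).
Proof.
move=> [_ _ tmax _] f g fh gh fg.
have := tmax f g fh gh; rewrite (_ : (fun _ => _) = g).
  by move=> ->; exact: vle_joinl.
by apply/funext => t; rewrite max_r.
Qed.

(** Stated for an arbitrary linear [tau], since [krivineP] uses it to prove that its candidate
    preserves meets. *)
Lemma comb_opp (tau : ('rV[R]_n -> R) -> E) :
  (forall (c : R) f g, homog_cont f -> homog_cont g ->
    tau (fun t => c * f t + g t) = c *: tau f + tau g) ->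
  tau (fun=> 0) = 0 /\ forall f, homog_cont f -> tau (fun t => - f t) = - tau f.
Proof.
move=> tl; have h0 : homog_cont (fun _ : 'rV[R]_n => 0 : R).
  apply: eq_homog_cont (homog_cont_scale 0 (homog_cont_l1norm n)) => t.
  exact: mul0r.
have t0 : tau (fun=> 0) = 0.
  have := tl (-1) _ _ h0 h0; rewrite scaleN1r addNr => <-; congr tau.
  by apply/funext => t; rewrite mulr0 addr0.
split=> // f fh; rewrite -scaleN1r -[RHS]addr0 -t0 -tl//.
by congr tau; apply/funext => t; rewrite mulN1r addr0.
Qed.

(** The axioms determine [tau] on linear forms, then on finite maxima, then on their differences. A
    function within [d * l1norm] of such a difference is squeezed by monotonicity. *)
Lemma is_krivine_approx tau : is_krivine x tau ->
  forall f, homog_cont f -> approx f (tau f).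
Proof.
move=> kt; have [tx tl tmax _] := kt => f fh e e0.
have [t0 _] := comb_opp tl.
have tdot a : tau (dotv a) = lin a.
  rewrite /dotv /lin; elim: (index_enum _) => [|j r IH].
    rewrite big_nil -[RHS]t0; congr tau; apply/funext => t; exact: big_nil.
  rewrite big_cons -IH -(tx j) -tl.
  - by congr tau; apply/funext => t; rewrite big_cons.
  - exact: homog_cont_coord.
  - apply: homog_cont_sum => i; apply: homog_cont_scale; exact: homog_cont_coord.
have tmx s g u : s != [::] -> max_of s g -> join_of s u -> tau g = u.
  elim: s g u => // a [|b s] IH g u _ sg su.
    rewrite (max_of_ext sg (max_of1 a)) tdot; apply: vle_ext => z.
    by rewrite su (join_of1 a).
  have [//|g' sg' gh'] := @max_of_ex _ _ (b :: s); have [//|u' su'] := @join_of_ex (b :: s).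
  have -> : g = (fun t => Num.max (dotv a t) (g' t)).
    by apply: max_of_ext sg _; exact: max_of_cat (max_of1 a) sg'.
  rewrite tmax//; last exact: homog_cont_dotv.
  rewrite tdot (IH g' u')//; apply: vle_ext => z.
  by rewrite su (join_of_cat (join_of1 a) su').
have tpwl g u : pwl g u -> tau g = u.
  move=> [s1 [s2 [f1 [f2 [u1 [u2 [[s1n s2n] [sf1 sf2] [su1 su2] -> ->]]]]]]].
  rewrite -(tmx s1 f1 u1)// -(tmx s2 f2 u2)// addrC -scaleN1r -tl.
  - by congr tau; apply/funext => t; rewrite mulN1r addrC.
  - exact: max_of_homog sf2.
  - exact: max_of_homog sf1.
pose d := e / (1 + `|vl1norm|).
have N0 : 0 < 1 + `|vl1norm| by rewrite ltr_wpDr.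
have d0 : 0 < d by rewrite divr_gt0.
have dE : d * (1 + `|vl1norm|) = e by rewrite mulfVK// gt_eqF.
have [g [u [gu fg]]] := pwl_dense fh d0.
exists g, u; split=> //.
  move=> t; apply: le_trans (fg t) _; rewrite ler_wpM2r ?l1norm_ge0//.
  by rewrite -dE ler_peMr ?(ltW d0)// lerDl.
have gh := pwl_homog gu.
have le1 : vle (tau f) (u + d *: vl1norm).
  rewrite -(tpwl _ _ gu) -(tpwl _ _ pwl_l1norm) addrC -tl//; last exact: homog_cont_l1norm.
  apply: (is_krivine_min kt) => //; first exact: homog_cont_comb _ (homog_cont_l1norm n) gh.
  by move=> t; have := fg t; rewrite ler_norml => /andP[_ ?]; lra.
have le2 : vle (- d *: vl1norm + u) (tau f).
  rewrite -(tpwl _ _ gu) -(tpwl _ _ pwl_l1norm) -tl//; last exact: homog_cont_l1norm.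
  apply: (is_krivine_min kt) => //; first exact: homog_cont_comb _ (homog_cont_l1norm n) gh.
  by move=> t; have := fg t; rewrite ler_norml => /andP[? _]; lra.
have : vle (vabs (tau f - u)) (d *: vl1norm).
  apply/vabs_leP; split; first by rewrite vle_addrR opprK addrC.
  move: le2; rewrite addrC vle_addrR scaleNr opprK => le2.
  by rewrite opprB vle_addrR opprK addrC.
move=> /vabs_le_norm/le_trans; apply; rewrite normrZ gtr0_norm// -dE.
by rewrite ler_wpM2l ?(ltW d0)// lerDr.
Qed.

(** The witness selects the [approx] value, which exists and is unique on H_n; each axiom then
    follows from uniqueness. *)
Lemma krivineP : is_krivine x (krivine x).
Proof.
apply: xgetPex; pose tau f := xget 0 [set u | approx f u]; exists tau.
have tauP f : homog_cont f -> approx f (tau f).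
  by move=> /approx_ex h; exact: xgetPex h.
have tmax f g : homog_cont f -> homog_cont g ->
    tau (fun t => Num.max (f t) (g t)) = vjoin (tau f) (tau g).
  move=> fh gh; apply: approx_uniq (tauP _ (homog_cont_max fh gh)) _.
  by apply: approx_max; exact: tauP.
have tl (c : R) f g : homog_cont f -> homog_cont g ->
    tau (fun t => c * f t + g t) = c *: tau f + tau g.
  move=> fh gh; apply: approx_uniq (tauP _ (homog_cont_comb c fh gh)) _.
  by apply: approx_comb; exact: tauP.
split=> // [j|f g fh gh].
  apply: approx_uniq (tauP _ (homog_cont_coord j)) _.
  by apply: pwl_approx; exact: pwl_coord.
have [_ tN] := comb_opp tl.
have hN h : homog_cont h -> homog_cont (fun t => - h t).
  by move=> hh; apply: eq_homog_cont (homog_cont_scale (-1) hh) => t; exact: mulN1r.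
rewrite vmeetE -!tN// -tmax; [|exact: hN|exact: hN].
rewrite -tN; last by apply: homog_cont_max; exact: hN.
by congr tau; apply/funext => t; rewrite oppr_max !opprK.
Qed.

Lemma krivine_unique tau : is_krivine x tau ->
  forall f, homog_cont f -> tau f = krivine x f.
Proof.
move=> kt f fh; apply: approx_uniq (is_krivine_approx kt fh) _.
exact: is_krivine_approx krivineP _ fh.
Qed.

End krivine_calculus.

(** * Rules of the calculus and the finite-dimensional p-norms *)

Section krivine_theory.
Context {R : realType} {E : banachLatticeType R}.

Section one_tuple.
Context (n : nat) (x : 'I_n -> E).
Implicit Types (f g : 'rV[R]_n -> R).

Lemma krivine_le f g : homog_cont f -> homog_cont g -> (forall t, f t <= g t) ->
  vle (krivine x f) (krivine x g).
Proof. exact: is_krivine_min (krivineP x) f g. Qed.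

Lemma krivine_coord j : krivine x (fun t => t ord0 j) = x j.
Proof. by have [] := krivineP x. Qed.

Lemma krivine_opp f : homog_cont f -> krivine x (fun t => - f t) = - krivine x f.
Proof. by have [_ h _ _] := krivineP x; apply: (comb_opp h).2. Qed.

Lemma krivine_abs f : homog_cont f -> krivine x (fun t => `|f t|) = vabs (krivine x f).
Proof.
move=> fh; rewrite /vabs -krivine_opp//; have [_ _ kmax _] := krivineP x.
rewrite -kmax//.
  congr krivine; apply/funext => t; case: (lerP 0 (f t)) => ft.
    by rewrite max_l ?ger0_norm//; lra.
  by rewrite max_r ?ltr0_norm//; lra.
by apply: eq_homog_cont (homog_cont_scale (-1) fh) => t; exact: mulN1r.
Qed.

Lemma krivine_scale (c : R) f : homog_cont f ->
  krivine x (fun t => c * f t) = c *: krivine x f.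
Proof.
move=> fh; have [_ h _ _] := krivineP x.
have h0 : homog_cont (fun _ : 'rV[R]_n => 0 : R).
  by apply: eq_homog_cont (homog_cont_scale 0 fh) => t; exact: mul0r.
rewrite -[RHS]addr0 -(comb_opp h).1 -h//.
by congr krivine; apply/funext => t; rewrite addr0.
Qed.

End one_tuple.

(** Substitution of [F] followed by the calculus of [x] satisfies the axioms for the tuple of the
    [krivine x (F i)], so uniqueness identifies it. *)
Lemma krivine_comp m n (x : 'I_n -> E) (F : 'I_m -> 'rV[R]_n -> R) h :
  homog_cont h -> (forall i, homog_cont (F i)) ->
  krivine (fun i => krivine x (F i)) h = krivine x (fun t => h (\row_i F i t)).
Proof.
move=> hh Fh; rewrite -(krivine_unique (x := fun i => krivine x (F i))
  (tau := fun h => krivine x (fun t => h (\row_i F i t))))//.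
have [_ kl kmax kmin] := krivineP x; split.
- by move=> j; congr krivine; apply/funext => t; rewrite mxE.
- by move=> a f g fh gh; rewrite -kl//; exact: homog_cont_comp.
- by move=> f g fh gh; rewrite -kmax//; exact: homog_cont_comp.
- by move=> f g fh gh; rewrite -kmin//; exact: homog_cont_comp.
Qed.

End krivine_theory.

(** Uniqueness again: [psi] after the calculus of [w] satisfies the axioms for the tuple of the
    [psi (w j)]. *)
Lemma krivine_hom {R : realType} {W E : banachLatticeType R} (psi : {linear W -> E})
    n (w : 'I_n -> W) h : lattice_hom psi -> homog_cont h ->
  psi (krivine w h) = krivine (fun j => psi (w j)) h.
Proof.
move=> [pj pm] hh; rewrite -(krivine_unique (x := fun j => psi (w j))
  (tau := fun h => psi (krivine w h)))//.
have [kc kl kmax kmin] := krivineP w; split.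
- by move=> j; rewrite kc.
- by move=> a f g fh gh; rewrite kl// linearP.
- by move=> f g fh gh; rewrite kmax// pj.
- by move=> f g fh gh; rewrite kmin// pm.
Qed.

(** * The l_p norms on R^n: duality, factorization and blocks *)

Section pnorm.
Context {R : realType}.

(** Differentiability settles the points other than 0. At 0 it may fail, the exponent being also
    taken to be an inverse, and the radius [e ^ (1 / r)] is used instead. *)
Lemma continuous_powR_abs (r : R) : 0 < r -> continuous (fun x : R => `|x| `^ r).
Proof.
move=> r0; suff h (x : R) : 0 < x -> {for x, continuous (fun x : R => x `^ r)}.
  move=> x; have [->|x0] := eqVneq x 0.
    apply/(@cvgrPdist_lt _ R^o) => e e0; rewrite normr0 powR0 ?gt_eqF//.
    near=> y; rewrite sub0r normrN ger0_norm ?powR_ge0//.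
    have -> : e = (e `^ r^-1) `^ r by rewrite -powRrM mulVf ?gt_eqF// powRr1// ltW.
    rewrite gt0_ltr_powR// ?nnegrE ?powR_ge0//.
    rewrite -[y]subr0 -normrN opprB; near: y.
    apply: (@nbhs_ballP _ R^o (0 : R) _).2.
    exists (e `^ r^-1); first by rewrite /= powR_gt0.
    by move=> y; rewrite -ball_normE.
  apply: (@continuous_comp R R R (fun x => `|x|) (fun x => x `^ r)).
    exact: (@norm_continuous _ R^o).
  by apply: h; rewrite normr_gt0.
move=> x0; apply/differentiable_continuous/derivable1_diffP.
by apply: derivable_powR; rewrite in_itv/= x0.
Unshelve. all: by end_near. Qed.

(* The case [p = -oo] is a junk value. *)
Definition pnorm (p : \bar R) (n : nat) (t : 'rV[R]_n) : R :=
  if p is r%:E then (\sum_j `|t ord0 j| `^ r) `^ r^-1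
  else \big[Num.max/0]_j `|t ord0 j|.

Lemma pnorm_ge0 (p : \bar R) n (t : 'rV[R]_n) : 0 <= pnorm p t.
Proof.
rewrite /pnorm; case: p => [r||]; first exact: powR_ge0.
  by apply/bigmax_geP; left.
by apply/bigmax_geP; left.
Qed.

Lemma pnorm_oo_le n (t : 'rV[R]_n) c :
  pnorm +oo%E t <= c <-> 0 <= c /\ forall j, `|t ord0 j| <= c.
Proof.
rewrite /pnorm; split.
  by move=> /bigmax_leP[c0 h]; split=> // j; exact: h.
by move=> [c0 h]; apply/bigmax_leP.
Qed.

Variable p : \bar R.
Hypothesis p1 : (1 <= p)%E.

Lemma pnorm_homog n : homog_cont (@pnorm p n).
Proof.
case: p p1 => [r||]; rewrite ?lee_fin// => r1; last first.
  rewrite /pnorm; elim: (index_enum _) => [|j s IH].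
    apply: eq_homog_cont (homog_cont_scale 0 (homog_cont_l1norm n)) => t.
    by rewrite big_nil mul0r.
  apply: eq_homog_cont (homog_cont_max (homog_cont_abs (homog_cont_coord j)) IH) => t.
  by rewrite big_cons.
have r0 : 0 < r by lra.
split=> [|c t c0].
  have -> : @pnorm r%:E n = (fun t => `|\sum_j `|t ord0 j| `^ r| `^ r^-1).
    apply/funext => t; rewrite /pnorm ger0_norm// sumr_ge0// => j _; exact: powR_ge0.
  move=> t; apply: (@continuous_comp _ _ _ (fun t : 'rV[R]_n => \sum_j `|t ord0 j| `^ r)
    (fun x : R => `|x| `^ r^-1)); last by apply: continuous_powR_abs; rewrite invr_gt0.
  apply: continuous_sumr => j _ {}t.
  apply: (@continuous_comp _ _ _ (fun t : 'rV[R]_n => t ord0 j) (fun x : R => `|x| `^ r)).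
    exact: coord_continuous.
  exact: continuous_powR_abs.
rewrite /pnorm (eq_bigr (fun j => c `^ r * `|t ord0 j| `^ r)); last first.
  by move=> j _; rewrite mxE normrM powRM// ger0_norm.
rewrite -mulr_sumr powRM ?powR_ge0//; last by apply: sumr_ge0 => j _; exact: powR_ge0.
by rewrite -powRrM mulfV ?gt_eqF// powRr1.
Qed.

Lemma pnorm1 (t : 'rV[R]_1) : pnorm p t = `|t ord0 ord0|.
Proof.
case: p p1 => [r||]; rewrite ?lee_fin// /pnorm => r1.
  by rewrite big_ord1 -powRrM mulfV ?powRr1//; lra.
by rewrite big_ord_recl big_ord0 max_l.
Qed.

(* The vector [w ^ (1 - 1 / r)] runs over the positive part of the unit sphere of
   the dual norm. *)
Lemma powR_hoelder n (r : R) (w : 'rV[R]_n) (t : 'rV[R]_n) : 1 <= r ->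
  (forall j, 0 <= w ord0 j) -> \sum_j w ord0 j = 1 ->
  \sum_j w ord0 j `^ (1 - r^-1) * `|t ord0 j| <= pnorm r%:E t.
Proof.
move=> r1 w0 w1; have r0 : 0 < r by lra.
set N := pnorm _ t; have N0 : 0 <= N by exact: powR_ge0.
have NE : N `^ r = \sum_j `|t ord0 j| `^ r.
  rewrite /N /pnorm -powRrM mulVf ?powRr1 ?gt_eqF//.
  by apply: sumr_ge0 => j _; exact: powR_ge0.
have [N00|Nn0] := eqVneq N 0.
  rewrite N00 big1// => j _; suff -> : t ord0 j = 0 by rewrite normr0 mulr0.
  move: NE; rewrite N00 powR0 ?gt_eqF// => /esym/eqP.
  rewrite psumr_eq0 => [/allP h|i _]; last exact: powR_ge0.
  have := h j (mem_index_enum _); rewrite implyTb => /eqP/powR_eq0_eq0.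
  by move=> /eqP; rewrite normr_eq0 => /eqP.
have Np : 0 < N by rewrite lt_neqAle eq_sym Nn0.
(* Young's inequality; [r = 1] is treated apart because its conjugate exponent is infinite. *)
have young (a b : R) : 0 <= a -> 0 <= b ->
    a `^ (1 - r^-1) * b <= (1 - r^-1) * a + r^-1 * b `^ r.
  move=> a0 b0; have [->|rn1] := eqVneq r 1.
    by rewrite invr1 subrr powRr0 mul0r add0r powRr1.
  have r1' : 1 < r by rewrite lt_neqAle eq_sym rn1.
  have ri : r^-1 < 1 by rewrite invf_lt1.
  have q0 : 0 < 1 - r^-1 by rewrite subr_gt0.
  have := @conjugate_powR R (a `^ (1 - r^-1)) b (1 - r^-1)^-1 r.
  rewrite -powRrM mulfV ?gt_eqF// powRr1// invrK [_ * a]mulrC [r^-1 * _]mulrC.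
  by apply; rewrite ?powR_ge0 ?invr_gt0 ?subrK.
rewrite -[leRHS]mulr1 -ler_pdivrMl// mulr_sumr.
(* After division by [N] the two parts of the Young bound sum to [1 - 1 / r] and [1 / r]. *)
apply: (@le_trans _ _ (\sum_j ((1 - r^-1) * w ord0 j + r^-1 * (N^-1 * `|t ord0 j|) `^ r))).
  apply: ler_sum => j _; rewrite mulrCA; apply: young => //.
  by rewrite mulr_ge0// invr_ge0.
rewrite big_split/= -!mulr_sumr w1 mulr1.
rewrite (eq_bigr (fun j => (N `^ r)^-1 * `|t ord0 j| `^ r)); last first.
  move=> j _; rewrite powRM ?invr_ge0//; congr (_ * _).
  by rewrite -(powR_inv1 N0) -powRrM mulN1r powRN.
by rewrite -mulr_sumr -NE mulVf ?mulr1 ?subrK// gt_eqF// powR_gt0.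
Qed.

(* Lozanovskii factorization of a probability vector. *)
Lemma pnorm_factor n (w : 'rV[R]_n) :
  (forall j, 0 <= w ord0 j) -> \sum_j w ord0 j = 1 ->
  exists a s : 'rV[R]_n,
    [/\ forall j, a ord0 j * s ord0 j = w ord0 j, pnorm p s = 1,
        forall j, 0 <= a ord0 j, forall j, 0 <= s ord0 j
      & forall t : 'rV[R]_n, \sum_j a ord0 j * `|t ord0 j| <= pnorm p t].
Proof.
move=> w0 w1; case: p p1 => [r||]; rewrite ?lee_fin// => r1.
  have r0 : 0 < r by lra.
  exists (\row_j w ord0 j `^ (1 - r^-1)), (\row_j w ord0 j `^ r^-1); split.
  - move=> j; rewrite !mxE -powRD subrK ?powRr1//.
    by rewrite oner_eq0.
  - rewrite /pnorm (eq_bigr (fun j => w ord0 j)) ?w1 ?powR1// => j _.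
    by rewrite mxE ger0_norm ?powR_ge0// -powRrM mulVf ?powRr1 ?gt_eqF.
  - by move=> j; rewrite mxE powR_ge0.
  - by move=> j; rewrite mxE powR_ge0.
  - move=> t; under eq_bigr do rewrite mxE.
    exact: powR_hoelder.
exists w, (const_mx 1); split=> //.
- by move=> j; rewrite mxE mulr1.
- case: n w w0 w1 => [|n] w w0 w1; first by move: w1; rewrite big_ord0 => /esym/eqP; rewrite oner_eq0.
  apply/eqP; rewrite eq_le; apply/andP; split.
    by apply/pnorm_oo_le; split=> // j; rewrite mxE normr1.
  by apply/bigmax_geP; right; exists ord0 => //; rewrite mxE normr1.
- by move=> j; rewrite mxE.
- move=> t; rewrite -[leRHS]mul1r -w1 mulr_suml; apply: ler_sum => j _.
  by apply: ler_wpM2l => //; apply/bigmax_geP; right; exists j.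
Qed.

(** A functional norming [s]: the equality case of Hoelder for a finite exponent, a signed unit
    vector at a coordinate of largest modulus for [+oo]. Monotonicity of [pnorm], its triangle
    inequality and [psum_le] come from it. *)
Lemma pnorm_support n (s : 'rV[R]_n) : exists a : 'rV[R]_n,
  dotv a s = pnorm p s /\ forall t : 'rV[R]_n, \sum_j `|a ord0 j| * `|t ord0 j| <= pnorm p t.
Proof.
have [s0|s0] := eqVneq (pnorm p s) 0.
  exists 0; split=> [|t]; first by rewrite /dotv s0 big1// => j _; rewrite mxE mul0r.
  by rewrite big1 ?pnorm_ge0// => j _; rewrite mxE normr0 mul0r.
have sp : 0 < pnorm p s by rewrite lt_neqAle eq_sym s0 pnorm_ge0.
case: p p1 s0 sp => [r||]; rewrite ?lee_fin// => r1 s0 sp; last first.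
  have [j sj] : exists j, pnorm +oo%E s <= `|s ord0 j|.
    have := lexx (pnorm +oo%E s); rewrite {2}/pnorm => /bigmax_geP[|[j _ h]]; last by exists j.
    by rewrite leNgt sp.
  have {}sj : pnorm +oo%E s = `|s ord0 j|.
    by apply/eqP; rewrite eq_le sj; apply/bigmax_geP; right; exists j.
  exists (Num.sg (s ord0 j) *: delta_mx ord0 j); split=> [|t].
    by rewrite dotvZl dotv_delta sj -normrEsg.
  rewrite (bigD1 j)//= big1 => [|i ij]; last first.
    by rewrite !mxE (negbTE ij) andbF mulr0 normr0 mul0r.
  rewrite addr0 !mxE !eqxx mulr1 normr_sg; apply: (@le_trans _ _ `|t ord0 j|).
    by rewrite ler_piMl//; case: (_ != 0).
  by apply/bigmax_geP; right; exists j.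
have r0 : 0 < r by lra.
set N := pnorm _ s in s0 sp *.
have NE : N `^ r = \sum_j `|s ord0 j| `^ r.
  rewrite /N /pnorm -powRrM mulVf ?powRr1 ?gt_eqF//.
  by apply: sumr_ge0 => j _; exact: powR_ge0.
(* The [r]-th powers of the normalised moduli form the probability vector at which [powR_hoelder] is
   an equality for [s]. *)
pose u : 'rV[R]_n := \row_j (`|s ord0 j| / N) .
pose w : 'rV[R]_n := \row_j (u ord0 j `^ r).
have u0 j : 0 <= u ord0 j by rewrite mxE divr_ge0// ltW.
have w0 j : 0 <= w ord0 j by rewrite mxE powR_ge0.
have w1 : \sum_j w ord0 j = 1.
  rewrite (eq_bigr (fun j => `|s ord0 j| `^ r * (N `^ r)^-1)); last first.
    move=> j _; rewrite !mxE powRM ?invr_ge0 ?(ltW sp)//; congr (_ * _).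
    by rewrite -(powR_inv1 (ltW sp)) -powRrM mulN1r powRN.
  by rewrite -mulr_suml -NE mulfV// gt_eqF// powR_gt0.
exists (\row_j (Num.sg (s ord0 j) * w ord0 j `^ (1 - r^-1))); split.
  rewrite -[RHS]mulr1 -[X in _ = _ * X]w1 mulr_sumr; apply: eq_bigr => j _.
  rewrite mxE mulrAC -normrEsg.
  have {2}-> : w ord0 j = w ord0 j `^ (1 - r^-1) * u ord0 j.
    have -> : u ord0 j = w ord0 j `^ r^-1.
      by rewrite [w ord0 j]mxE -powRrM mulfV ?powRr1 ?gt_eqF.
    by rewrite -powRD subrK ?powRr1// oner_eq0.
  by rewrite [u ord0 j]mxE [RHS]mulrCA [N * _]mulrC divfK// mulrC.
move=> t; apply: le_trans (powR_hoelder t r1 w0 w1); apply: ler_sum => j _.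
rewrite mxE normrM normr_sg (ger0_norm (powR_ge0 _ _)) ler_wpM2r//.
by rewrite ler_piMl ?powR_ge0//; case: (_ != 0).
Qed.

(** Associativity of l_p sums. Blocks of varying length are indexed by dependent pairs, enumerated
    by [enum_val] because [pnorm] acts on rows. *)
Lemma pnorm_block n (m : 'I_n -> nat) (t : {i : 'I_n & 'I_(m i)} -> R) :
  pnorm p (\row_(k < #|{: {i : 'I_n & 'I_(m i)}}|) t (enum_val k)) =
  pnorm p (\row_(i < n) pnorm p (\row_(j < m i) t (Tagged (fun i => 'I_(m i)) j))).
Proof.
case: p p1 => [r||]; rewrite ?lee_fin// => r1.
  have r0 : 0 < r by lra.
  rewrite /pnorm; congr (_ `^ _).
  under [RHS]eq_bigr => i _.
    rewrite mxE ger0_norm ?powR_ge0// -powRrM mulVf ?gt_eqF// powRr1; last first.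
      by apply: sumr_ge0 => j _; exact: powR_ge0.
    under eq_bigr do rewrite mxE.
    over.
  rewrite (sig_big_dep (fun=> true) (fun _ _ => true)
    (fun i j => `|t (Tagged (fun i => 'I_(m i)) j)| `^ r))/=.
  under eq_bigr do rewrite mxE.
  rewrite -(big_enum_val (A := {: {i : 'I_n & 'I_(m i)}}) (fun u => `|t u| `^ r)).
  by apply: eq_bigr => -[].
apply/eqP; rewrite eq_le; apply/andP; split; apply/pnorm_oo_le.
  split; first exact: pnorm_ge0.
  move=> k; rewrite mxE; case: (enum_val k) => i j.
  apply: le_trans (_ : pnorm +oo%E (\row_(j < m i) t (Tagged (fun i => 'I_(m i)) j)) <= _).
    by apply/bigmax_geP; right; exists j => //; rewrite mxE.
  apply/bigmax_geP; right; exists i => //; rewrite mxE ger0_norm//.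
  by apply/bigmax_geP; left.
split; first by apply/bigmax_geP; left.
move=> i; rewrite mxE ger0_norm; last by apply/bigmax_geP; left.
apply/pnorm_oo_le; split; first by apply/bigmax_geP; left.
move=> j; rewrite mxE; apply/bigmax_geP; right.
by exists (enum_rank (Tagged (fun i => 'I_(m i)) j)) => //; rewrite mxE enum_rankK.
Qed.

End pnorm.

(** * The p-sum of vectors of a Banach lattice *)

Section psum.
Context {R : realType} (p : \bar R).
Hypothesis p1 : (1 <= p)%E.

Lemma pnorm_mono n (s t : 'rV[R]_n) :
  (forall j, `|s ord0 j| <= `|t ord0 j|) -> pnorm p s <= pnorm p t.
Proof.
move=> st; have [a [<- ha]] := pnorm_support p1 s; apply: le_trans (ha t).
apply: ler_sum => j _; apply: le_trans (ler_norm _) _; rewrite normrM.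
exact: ler_wpM2l.
Qed.

Lemma pnormZ n (c : R) (t : 'rV[R]_n) : 0 <= c -> pnorm p (c *: t) = c * pnorm p t.
Proof. exact: (pnorm_homog p1 n).2. Qed.

Lemma pnormD n (s t : 'rV[R]_n) : pnorm p (s + t) <= pnorm p s + pnorm p t.
Proof.
have [a [<- ha]] := pnorm_support p1 (s + t); rewrite dotvDr.
by apply: lerD; [apply: le_trans (ha s)|apply: le_trans (ha t)];
  apply: ler_sum => j _; apply: le_trans (ler_norm _) _; rewrite normrM.
Qed.

Section one_lattice.
Context {E : banachLatticeType R}.

Definition psum n (x : 'I_n -> E) : E := krivine x (@pnorm R p n).

(** The unit ball of the dual norm. Since [pnorm] ignores signs, testing with moduli gives the same
    set, in the form that [psum_ge] needs. *)
Definition dual_ball n (a : 'rV[R]_n) :=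
  forall t : 'rV[R]_n, \sum_j `|a ord0 j| * `|t ord0 j| <= pnorm p t.

Lemma psum_ge n (x : 'I_n -> E) a : dual_ball a ->
  vle (\sum_j `|a ord0 j| *: vabs (x j)) (psum x).
Proof.
move=> ha; set f := fun t : 'rV[R]_n => \sum_j `|a ord0 j| * `|t ord0 j|.
have fu : pwl x f (\sum_j `|a ord0 j| *: vabs (x j)).
  by apply: pwl_sum => j; apply: pwl_scale; apply: pwl_abs; exact: pwl_coord.
(* Uniqueness identifies the explicit [pwl] value of a piecewise linear function with its Krivine
   value. *)
rewrite -(approx_uniq (is_krivine_approx (krivineP x) (pwl_homog fu)) (pwl_approx fu)).
by apply: krivine_le => //; [exact: pwl_homog fu|exact: pnorm_homog].
Qed.

Lemma vabs_lin n (x : 'I_n -> E) a :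
  vle (vabs (lin x a)) (\sum_j `|a ord0 j| *: vabs (x j)).
Proof.
rewrite (eq_bigr (fun j => vabs (a ord0 j *: x j))); first exact: vabs_sum.
by move=> j _; rewrite vabsZ.
Qed.

(* [psum x] is the least upper bound of the combinations of [x] with
   coefficients in the dual unit ball. *)
Lemma psum_le n (x : 'I_n -> E) u :
  (forall a, dual_ball a -> vle (lin x a) u) -> vle (psum x) u.
Proof.
move=> h; apply: vle_closed => e e0; pose N := 1 + `|vl1norm x|.
have N0 : 0 < N by rewrite ltr_wpDr.
have d0 : 0 < e / N by rewrite divr_gt0.
(* Maxima of finitely many forms of the dual ball. A form norming each point of the sphere lets
   [max_cover] approximate [pnorm] by one of them. *)
pose P (g : 'rV[R]_n -> R) := exists2 s, s != [::] &
  max_of s g /\ forall a, a \in s -> dual_ball a.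
have [||||g [s s0 [sg sd]] hg] := @max_cover R n P (@pnorm R p n) _ d0 (pnorm_homog p1 n).
- by move=> g [s s0 [sg _]]; exact: max_of_homog sg.
- move=> g g' [s s0 [sg sd]] [s' s0' [sg' sd']]; exists (s ++ s').
    by case: (s) s0.
  split; first exact: max_of_cat.
  by move=> a; rewrite mem_cat => /orP[/sd|/sd'].
- exists (dotv 0); first exists [:: 0] => //.
    split; first exact: max_of1.
    move=> a; rewrite inE => /eqP -> t; rewrite big1 ?pnorm_ge0// => j _.
    by rewrite mxE normr0 mul0r.
  move=> t; rewrite /dotv big1 => [|j _]; last by rewrite mxE mul0r.
  by rewrite addr_ge0 ?pnorm_ge0// mulr_ge0 ?l1norm_ge0// ltW.
- move=> s Ss; have [a [as_ ha]] := pnorm_support p1 s.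
  exists (dotv a); first exists [:: a] => //.
    by split; [exact: max_of1|move=> b; rewrite inE => /eqP ->].
  split; last by rewrite as_ ltrBlDr ltrDl.
  move=> t; apply: (@le_trans _ _ (pnorm p t)); last first.
    by rewrite lerDl mulr_ge0 ?l1norm_ge0// ltW.
  apply: le_trans (ha t); apply: ler_sum => j _; apply: le_trans (ler_norm _) _.
  by rewrite normrM.
have [w sw] := join_of_ex x s0.
have gw : pwl x g w.
  exists s, [:: 0], g, (dotv 0), w, (lin x 0); split=> //.
  - by split=> //; exact: max_of1.
  - by split=> //; exact: join_of1.
  - apply/funext => t; rewrite [X in _ - X](_ : _ = 0) ?subr0//.
    by rewrite -(scale0r (0 : 'rV[R]_n)) dotvZl mul0r.
  - by rewrite -(scale0r (0 : 'rV[R]_n)) linZ scale0r subr0.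
have wu : vle w u by apply/sw => a sa; apply: h; exact: sd.
exists (e / N *: vl1norm x).
  rewrite normrZ gtr0_norm// mulrAC ler_pdivrMr// ler_wpM2l ?(ltW e0)//.
  by rewrite lerDr.
apply: (vle_trans (e / N *: vl1norm x + w)); last first.
  by rewrite addrC; apply: vle_lerD => //; exact: vle_refl.
have gw' := pwl_comb (e / N) (pwl_l1norm x) gw.
rewrite -(approx_uniq (is_krivine_approx (krivineP x) (pwl_homog gw')) (pwl_approx gw')).
apply: krivine_le; [exact: pnorm_homog|exact: pwl_homog gw'|move=> t].
by have := hg t; rewrite ler_norml => /andP[_ ?]; lra.
Qed.

Lemma lin_le_psum n (x : 'I_n -> E) a : dual_ball a -> vle (lin x a) (psum x).
Proof.
move=> ha; apply: (vle_trans (vabs (lin x a))); first exact: vle_abs.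
by apply: (vle_trans _ (vabs_lin x a)); exact: psum_ge.
Qed.

Lemma psum_ge0 n (x : 'I_n -> E) : vle 0 (psum x).
Proof.
have -> : 0 = lin x 0 by rewrite -(scale0r (0 : 'rV[R]_n)) linZ scale0r.
apply: lin_le_psum => t; rewrite big1 ?pnorm_ge0// => j _.
by rewrite mxE normr0 mul0r.
Qed.

Lemma psum_mono n (x y : 'I_n -> E) :
  (forall j, vle (vabs (x j)) (vabs (y j))) -> vle (psum x) (psum y).
Proof.
move=> xy; apply: psum_le => a ha; apply: (vle_trans (vabs (lin x a))).
  exact: vle_abs.
apply: (vle_trans _ (vabs_lin x a)); apply: (vle_trans _ _ (psum_ge y ha)).
by apply: vle_sum => j _; exact: vle_scale.
Qed.

Lemma psumD n (x y : 'I_n -> E) :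
  vle (psum (fun j => x j + y j)) (psum x + psum y).
Proof.
apply: psum_le => a ha; rewrite (_ : lin _ a = lin x a + lin y a).
  by apply: vle_lerD; exact: lin_le_psum.
by rewrite -big_split; apply: eq_bigr => j _; rewrite scalerDr.
Qed.

Lemma psumZZ n (c : 'I_n -> R) (x : 'I_n -> E) :
  psum (fun j => c j *: x j) = krivine x (fun t => pnorm p (\row_j (c j * t ord0 j))).
Proof.
rewrite -(@krivine_comp _ _ _ _ x (fun j t => c j * t ord0 j)).
- congr krivine; apply/funext => j; rewrite krivine_scale ?krivine_coord//.
  exact: homog_cont_coord.
- exact: pnorm_homog.
- by move=> j; apply: homog_cont_scale; exact: homog_cont_coord.
Qed.

Lemma psumZ n (c : R) (x : 'I_n -> E) : 0 <= c ->
  psum (fun j => c *: x j) = c *: psum x.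
Proof.
move=> c0; rewrite psumZZ -krivine_scale; last exact: pnorm_homog.
congr krivine; apply/funext => t; rewrite -pnormZ//; congr pnorm.
by apply/rowP => j; rewrite !mxE.
Qed.

Lemma psum1 (x : 'I_1 -> E) : psum x = vabs (x ord0).
Proof.
rewrite -(krivine_coord x ord0) -krivine_abs; last exact: homog_cont_coord.
by congr krivine; apply/funext => t; exact: pnorm1.
Qed.

Lemma psum_block n (m : 'I_n -> nat) (x : {i : 'I_n & 'I_(m i)} -> E) :
  psum (fun k : 'I_#|{: {i : 'I_n & 'I_(m i)}}| => x (enum_val k)) =
  psum (fun i => psum (fun j : 'I_(m i) => x (Tagged (fun i => 'I_(m i)) j))).
Proof.
set y := fun k : 'I_#|{: {i : 'I_n & 'I_(m i)}}| => x (enum_val k).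
pose F i (t : 'rV[R]_#|{: {i : 'I_n & 'I_(m i)}}|) :=
  pnorm p (\row_(j < m i) t ord0 (enum_rank (Tagged (fun i => 'I_(m i)) j))).
have Fh i : homog_cont (F i).
  apply: homog_cont_comp; first exact: pnorm_homog.
  by move=> j; exact: homog_cont_coord.
have -> : (fun i => psum (fun j : 'I_(m i) => x (Tagged (fun i => 'I_(m i)) j))) =
    (fun i => krivine y (F i)).
  apply/funext => i; rewrite -(@krivine_comp _ _ _ _ y (fun (j : 'I_(m i)) t =>
    t ord0 (enum_rank (Tagged (fun i => 'I_(m i)) j)))).
  - congr krivine; apply/funext => j; rewrite krivine_coord /y enum_rankK//.
  - exact: pnorm_homog.
  - by move=> j; exact: homog_cont_coord.
rewrite /psum krivine_comp//; last exact: pnorm_homog.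
congr krivine; apply/funext => t.
rewrite -(pnorm_block p1 (fun u => t ord0 (enum_rank u))); congr pnorm.
by apply/rowP => k; rewrite mxE enum_valK.
Qed.

(** Subadditivity and [psum z <= B *: vl1norm z] give norm continuity, through which [chull_psum]
    passes from the hull to its closure. *)
Lemma psum_dist n : exists2 B, 0 <= B & forall x y : 'I_n -> E,
  `|psum x - psum y| <= B * \sum_j `|x j - y j|.
Proof.
have [B B0 hB] := homog_cont_bound (pnorm_homog p1 n); exists B => // x y.
have bd (z : 'I_n -> E) : vle (psum z) (B *: vl1norm z).
  have h := pwl_scale B (pwl_l1norm z).
  rewrite -(approx_uniq (is_krivine_approx (krivineP z) (pwl_homog h)) (pwl_approx h)).
  apply: krivine_le; [exact: pnorm_homog|exact: pwl_homog h|move=> t].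
  exact: le_trans (ler_norm _) (hB t).
have half (u v : 'I_n -> E) :
    vle (psum u - psum v) (B *: \sum_j vabs (u j - v j)).
  rewrite vle_addrR opprK; apply: (vle_trans (psum (fun j => u j - v j) + psum v)).
    have := psumD (fun j => u j - v j) v; congr (vle (psum _) _).
    by apply/funext => j; rewrite subrK.
  by apply: vle_add; exact: bd.
apply: le_trans (_ : `|B *: \sum_j vabs (x j - y j)| <= _).
  apply: vabs_le_norm; apply/vabs_leP; split; first exact: half.
  rewrite opprB; have := half y x; congr (vle _ (B *: _)).
  by apply: eq_bigr => j _; rewrite -vabsN opprB.
rewrite normrZ ger0_norm// ler_wpM2l//; apply: le_trans (ler_norm_sum _ _ _) _.
by apply: ler_sum => j _; rewrite vnorm_abs.
Qed.

(** Controls the perturbation of the slopes in [slopes_bound]. *)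
Lemma psum_scalar n (t : 'rV[R]_n) (e : E) :
  `|psum (fun j => t ord0 j *: e)| <= pnorm p t * `|e|.
Proof.
rewrite -[X in _ <= X * _]ger0_norm ?pnorm_ge0// -(vnorm_abs e) -normrZ.
apply: vle_norm; first exact: psum_ge0.
apply: psum_le => a ha; apply: (vle_trans _ (vle_abs _)).
apply: (vle_trans _ (vabs_lin _ a)); under eq_bigr do rewrite vabsZ scalerA.
rewrite -scaler_suml; apply: vle_scaler; last exact: vabs_ge0.
exact: ha.
Qed.

End one_lattice.

Lemma psum_positive (W E : banachLatticeType R) (psi : {linear W -> E}) n
    (w : 'I_n -> W) : positive_op psi ->
  vle (psum (fun j => psi (w j))) (psi (psum w)).
Proof.
move=> psi0; apply: psum_le => a /(lin_le_psum w).
rewrite vle_subr0 => /psi0; rewrite linearB -vle_subr0; congr vle.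
by rewrite linear_sum; apply: eq_bigr => j _; rewrite linearZ.
Qed.

Lemma psum_hom (W E : banachLatticeType R) (psi : {linear W -> E}) n
    (w : 'I_n -> W) : lattice_hom psi ->
  psi (psum w) = psum (fun j => psi (w j)).
Proof. by move=> h; apply: krivine_hom => //; exact: pnorm_homog. Qed.

End psum.

(** * Both convexity conditions in terms of p-sums *)

Section bounds.
Context {R : realType}.
Implicit Type p : \bar R.

Lemma vsup_le (E : banachLatticeType R) n (x : 'I_n -> E) z :
  vle (vsup x) z <-> vle 0 z /\ forall j, vle (x j) z.
Proof.
rewrite /vsup; suff h (s : seq 'I_n) : vle (\big[vjoin/0]_(j <- s) x j) z <->
    vle 0 z /\ forall j, j \in s -> vle (x j) z.
  rewrite h; split=> -[z0 hz]; split=> // j; apply: hz; exact: mem_index_enum.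
elim: s => [|i s IH]; first by rewrite big_nil; split=> [|[]].
rewrite big_cons vjoinP IH; split=> [[xi [z0 hz]]|[z0 hz]].
  by split=> // j; rewrite inE => /predU1P[->|/hz].
split; first by apply: hz; exact: mem_head.
by split=> // j js; apply: hz; rewrite inE js orbT.
Qed.

(** Unit vectors belong to the dual ball, so [psum] dominates each [|x j|]. Conversely, testing a
    member of the dual ball at the constant vector 1 bounds the sum of its moduli by 1. *)
Lemma psum_oo (E : banachLatticeType R) n (x : 'I_n -> E) :
  vsup (fun j => vabs (x j)) = psum +oo%E x.
Proof.
have oo1 : (1 <= +oo :> \bar R)%E by exact: leey.
apply: vle_anti.
  apply/vsup_le; split; first exact: psum_ge0.
  move=> j; have dj : dual_ball +oo%E (delta_mx ord0 j : 'rV[R]_n).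
    move=> t; rewrite (bigD1 j)//= mxE !eqxx big1 => [|i /negbTE ij].
      by rewrite normr1 mul1r addr0; apply/bigmax_geP; right; exists j.
    by rewrite mxE ij andbF normr0 mul0r.
  have := psum_ge oo1 x dj; rewrite (bigD1 j)//= mxE !eqxx big1 => [|i /negbTE ij].
    by rewrite normr1 scale1r addr0.
  by rewrite mxE ij andbF normr0 scale0r.
apply: psum_le => // a ha; apply: (vle_trans _ (vle_abs _)).
apply: (vle_trans _ (vabs_lin x a)); set z := vsup _.
have [z0 hz] := (vsup_le (fun j => vabs (x j)) z).1 vle_refl.
apply: (vle_trans (\sum_j `|a ord0 j| *: z)).
  by apply: vle_sum => j _; apply: vle_scale.
rewrite -scaler_suml -[X in vle _ X]scale1r; apply: vle_scaler => //.
have := ha (const_mx 1); under eq_bigr do rewrite mxE normr1 mulr1.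
move=> /le_trans; apply; apply/pnorm_oo_le; split=> // j.
by rewrite mxE normr1.
Qed.

Lemma exponentP p : (1 <= p)%E -> (exists2 r, p = r%:E & 1 <= r) \/ p = +oo%E.
Proof. by case: p => [r||] h; [left; exists r|right|]. Qed.

Lemma pconvex_boundE p (W : banachLatticeType R) M : (1 <= p)%E ->
  pconvex_bound p (idmap W) M <-> 0 <= M /\ forall n (v : 'I_n -> W),
    `|psum p v| <= M * pnorm p (\row_j `|v j|).
Proof.
move=> /exponentP[[r -> r1]|->].
  have rowE n (v : 'I_n -> W) : (\sum_(j < n) `|v j| `^ r) `^ r^-1 =
      pnorm r%:E (\row_j `|v j|).
    by congr (_ `^ _); apply: eq_bigr => j _; rewrite mxE normr_id.
  have krE n (v : 'I_n -> W) : krivine (fun j => idmap W (v j))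
      (fun t => (\sum_(j < n) `|t ord0 j| `^ r) `^ r^-1) = psum r%:E v.
    by rewrite (_ : (fun j => idmap W (v j)) = v).
  by split=> -[M0 h]; (split; first exact: M0) => n v;
    [rewrite -krE -rowE; exact: (h n v)|rewrite krE rowE; exact: (h n v)].
have rowE n (v : 'I_n -> W) : \big[Num.max/0]_(j < n) `|v j| =
    pnorm +oo%E (\row_j `|v j|).
  by apply: eq_bigr => j _; rewrite mxE normr_id.
have krE n (v : 'I_n -> W) : vsup (fun j => vabs (idmap W (v j))) = psum +oo%E v.
  exact: psum_oo.
by split=> -[M0 h]; (split; first exact: M0) => n v;
  [rewrite -krE -rowE; exact: (h n v)|rewrite krE rowE; exact: (h n v)].
Qed.

(** For a finite exponent [r] the weights are written [c j ^ r] and moved inside the modulus; for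
    [+oo] they are kept. Both cases become one inequality between [psum] and [pnorm]. *)
Lemma lip_pconvex_boundE p (X : metricType R) (E : banachLatticeType R)
    (T : X -> E) C : (1 <= p)%E ->
  lip_pconvex_bound p T C <-> 0 <= C /\ forall n (x x' : 'I_n -> X) (c : 'I_n -> R),
    (forall j, 0 <= c j) ->
    `|psum p (fun j => c j *: (T (x j) - T (x' j)))|
      <= C * pnorm p (\row_j (c j * mdist (x j) (x' j))).
Proof.
move=> /exponentP[[r -> r1]|->].
  have r0 : 0 < r by lra.
  have cr (a : R) : 0 <= a -> (a `^ r) `^ r^-1 = a.
    by move=> a0; rewrite -powRrM mulfV ?powRr1 ?gt_eqF.
  have rc (a : R) : 0 <= a -> (a `^ r^-1) `^ r = a.
    by move=> a0; rewrite -powRrM mulVf ?powRr1 ?gt_eqF.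
  have key n (x x' : 'I_n -> X) (c : 'I_n -> R) : (forall j, 0 <= c j) ->
     (krivine (fun j => T (x j) - T (x' j))
        (fun t => (\sum_(j < n) c j `^ r * `|t ord0 j| `^ r) `^ r^-1)
       = psum r%:E (fun j => c j *: (T (x j) - T (x' j)))) *
     ((\sum_(j < n) c j `^ r * mdist (x j) (x' j) `^ r) `^ r^-1
       = pnorm r%:E (\row_j (c j * mdist (x j) (x' j)))).
    move=> c0; split.
      rewrite psumZZ//; congr krivine; apply/funext => t.
      congr (_ `^ _); apply: eq_bigr => j _.
      by rewrite mxE normrM powRM// ger0_norm.
    congr (_ `^ _); apply: eq_bigr => j _.
    by rewrite mxE normrM powRM// !ger0_norm ?mdist_ge0.
  split=> -[C0 h]; split=> // n x x' c c0.
    by rewrite -!key//; apply: h => j; exact: powR_ge0.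
  have c0' j : 0 <= c j `^ r^-1 by exact: powR_ge0.
  have := h n x x' _ c0'; rewrite -!key//; congr (`|krivine _ _| <= _ * (_ `^ _)).
    by apply/funext => t; congr (_ `^ _); apply: eq_bigr => j _; rewrite rc.
  by apply: eq_bigr => j _; rewrite rc.
have key n (x x' : 'I_n -> X) (c : 'I_n -> R) : (forall j, 0 <= c j) ->
   (vsup (fun j => c j *: vabs (T (x j) - T (x' j)))
     = psum +oo%E (fun j => c j *: (T (x j) - T (x' j)))) *
   (\big[Num.max/0]_(j < n) (c j * mdist (x j) (x' j))
     = pnorm +oo%E (\row_j (c j * mdist (x j) (x' j)))).
  move=> c0; split.
    rewrite -psum_oo; congr vsup; apply/funext => j.
    by rewrite vabsZ ger0_norm.
  by apply: eq_bigr => j _; rewrite mxE ger0_norm// mulr_ge0 ?mdist_ge0.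
by split=> -[C0 h]; split=> // n x x' c c0; have := h n x x' c c0; rewrite !key.
Qed.

End bounds.

(** * The Banach lattice with a given unit ball *)

(* [gauge_le x m] reads: [x] belongs to [m] times the unit ball. *)
Record gauge (R : realType) (E : banachLatticeType R) := Gauge {
  gauge_le : E -> R -> Prop ;
  gauge_ge0 : forall x m, gauge_le x m -> 0 <= m ;
  gauge00 : gauge_le 0 0 ;
  gauge_mono : forall x m m', m <= m' -> gauge_le x m -> gauge_le x m' ;
  gaugeD : forall x y m m', gauge_le x m -> gauge_le y m' ->
    gauge_le (x + y) (m + m') ;
  gaugeZ : forall (c : R) x m, gauge_le x m -> gauge_le (c *: x) (`|c| * m) ;
  gauge_inf : forall x m,
    (forall e : R, 0 < e -> gauge_le x (m + e)) -> gauge_le x m ;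
  gauge_closed : forall x m,
    (forall e : R, 0 < e -> exists2 y, `|x - y| <= e & gauge_le y m) ->
    gauge_le x m ;
  gauge_solid : forall x y m, vle (vabs y) (vabs x) -> gauge_le x m -> gauge_le y m ;
  gauge_bound : exists2 C, 0 <= C & forall x m, gauge_le x m -> `|x| <= C * m
}.

Section gauge_space.
Context {R : realType} {E : banachLatticeType R} (g : gauge E).

Definition gauge_span : {pred E} := fun x => `[< exists m, gauge_le g x m >].

Lemma gauge_spanP x : reflect (exists m, gauge_le g x m) (x \in gauge_span).
Proof. exact: asboolP. Qed.

Lemma gauge_span_submod : submod_closed gauge_span.
Proof.
split=> [|c x y /gauge_spanP[m xm] /gauge_spanP[m' ym']]; apply/gauge_spanP.
  by exists 0; exact: gauge00.
by exists (`|c| * m + m'); apply: gaugeD => //; exact: gaugeZ.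
Qed.

HB.instance Definition _ :=
  GRing.isSubmodClosed.Build R E gauge_span gauge_span_submod.

Definition gauge_space := {x : E | x \in gauge_span}.

HB.instance Definition _ := SubType.on gauge_space.
HB.instance Definition _ := Choice.on gauge_space.
HB.instance Definition _ := [SubChoice_isSubLmodule of gauge_space by <:].

Implicit Types (w z : gauge_space).

Definition gauge_incl : {linear gauge_space -> E} := \val.

Lemma gauge_inclP w : exists m, gauge_le g (gauge_incl w) m.
Proof. exact/gauge_spanP/valP. Qed.

Lemma gauge_incl_inj : injective gauge_incl.
Proof. exact: val_inj. Qed.

Lemma gauge_incl_ex x m : gauge_le g x m -> exists w, gauge_incl w = x.
Proof.
move=> xm; have xg : x \in gauge_span by apply/gauge_spanP; exists m.
by exists (Sub x xg); exact: SubK.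
Qed.

Definition gauge_norm w : R := inf [set m | gauge_le g (gauge_incl w) m].


Lemma gauge_norm_ge0 w : 0 <= gauge_norm w.
Proof.
have [m wm] := gauge_inclP w.
by apply: lb_le_inf; [exists m|move=> k wk'; exact: gauge_ge0 wk'].
Qed.

(** By [gauge_inf] the infimum is attained, so that norm estimates become membership statements. *)
Lemma gauge_normP w m : gauge_norm w <= m <-> gauge_le g (gauge_incl w) m.
Proof.
split=> [wm|wm]; last by apply: ge_inf => //; exists 0 => k wk'; exact: gauge_ge0 wk'.
apply: gauge_inf => e e0; have : gauge_norm w < m + e by rewrite ltr_pwDr.
have [m0 wm0] := gauge_inclP w.
move=> /inf_lt[|k wk /ltW ke]; first by exists m0.
exact: gauge_mono ke wk.
Qed.

Lemma gauge_norm_le w : gauge_le g (gauge_incl w) (gauge_norm w).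
Proof. exact/gauge_normP. Qed.

Lemma gauge_normD w z : gauge_norm (w + z) <= gauge_norm w + gauge_norm z.
Proof. by apply/gauge_normP; rewrite linearD; apply: gaugeD; exact: gauge_norm_le. Qed.

Lemma gauge_normZ_le (c : R) w : gauge_norm (c *: w) <= `|c| * gauge_norm w.
Proof. by apply/gauge_normP; rewrite linearZ; apply: gaugeZ; exact: gauge_norm_le. Qed.

Lemma gauge_normZ (c : R) w : gauge_norm (c *: w) = `|c| * gauge_norm w.
Proof.
apply/eqP; rewrite eq_le gauge_normZ_le/=.
have [->|c0] := eqVneq c 0; first by rewrite normr0 mul0r gauge_norm_ge0.
rewrite -ler_pdivlMl ?normr_gt0// -normfV.
by have := gauge_normZ_le c^-1 (c *: w); rewrite scalerA mulVf// scale1r.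
Qed.

Lemma gauge_norm_bound : exists2 C, 0 <= C & forall w, `|gauge_incl w| <= C * gauge_norm w.
Proof.
have [C C0 h] := gauge_bound g; exists C => // w; apply: h; exact: gauge_norm_le.
Qed.

Lemma gauge_norm_eq0 w : gauge_norm w = 0 -> w = 0.
Proof.
move=> w0; have [C _ /(_ w)] := gauge_norm_bound; rewrite w0 mulr0 normr_le0 => /eqP h.
by apply: gauge_incl_inj; rewrite h linear0.
Qed.

HB.instance Definition _ := Lmodule_isNormed.Build R gauge_space
  gauge_normD gauge_normZ gauge_norm_eq0.

Lemma gauge_normE w : `|w| = gauge_norm w. Proof. by []. Qed.

(** The inclusion is bounded, so a Cauchy filter has a limit in [E]. As gauge balls are closed in
    [E], the limit stays in the span and is approached in the gauge norm too. *)
Lemma gauge_space_complete (F : set_system gauge_space) :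
  ProperFilter F -> cauchy F -> cvg F.
Proof.
move=> FF /cauchyP Fc; have [C C0 hC] := gauge_norm_bound.
have near0 (e : R) : 0 < e -> exists w0, \forall w \near F, `|w0 - w| < e.
  by move=> e0; have [w0 h] := Fc e e0; exists w0; rewrite -ball_normE in h.
have : cvg (gauge_incl @ F : set_system E).
  apply/cauchy_cvgP/cauchyP => e e0.
  have e1 : 0 < e / (C + 1) by rewrite divr_gt0// ltr_wpDl.
  have [w0 h] := near0 _ e1; exists (gauge_incl w0).
  apply: filterS h => w h; rewrite -ball_normE.
  change (`|gauge_incl w0 - gauge_incl w| < e); rewrite -(linearB gauge_incl); apply: le_lt_trans (hC _) _.
  rewrite -gauge_normE; apply: le_lt_trans (_ : (C + 1) * `|w0 - w| < _).
    by apply: ler_wpM2r => //; rewrite lerDl.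
  by rewrite mulrC -ltr_pdivlMr// ltr_wpDl.
move=> /cvg_ex[x Fx].
have key (e : R) w0 : 0 < e -> (\forall w \near F, `|w0 - w| < e) ->
    gauge_le g (gauge_incl w0 - x) e.
  move=> e0 h; apply: gauge_closed => d d0.
  have hx : \forall w \near F, `|x - gauge_incl w| <= d.
    by move/cvgrPdist_le : Fx => /(_ d d0).
  have [w [h1 h2]] := filter_ex (filterI h hx).
  exists (gauge_incl (w0 - w)).
    rewrite (_ : _ - _ = - (x - gauge_incl w)) ?normrN//.
    by rewrite (linearB gauge_incl) !opprB addrC addrA subrK.
  by apply/gauge_normP; exact: ltW.
have [v vx] : exists v, gauge_incl v = x.
  have [w0 h0] := near0 1 ltr01; have h := key _ _ ltr01 h0.
  have [u hu] := gauge_incl_ex h; exists (w0 - u).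
  by rewrite (linearB gauge_incl) hu subKr.
apply/cvg_ex; exists v; apply/cvgrPdist_le => e e0.
have e2 : 0 < e / 2 by rewrite divr_gt0.
have [w0 h0] := near0 _ e2; have h := key _ _ e2 h0.
apply: filterS h0 => w h0; rewrite [leRHS](splitr e).
rewrite -[v](subrK w0) -addrA; apply: le_trans (ler_normD _ _) _; apply: lerD.
  by rewrite distrC gauge_normE; apply/gauge_normP; rewrite (linearB gauge_incl) vx.
exact: ltW.
Qed.

HB.instance Definition _ := Uniform_isComplete.Build gauge_space gauge_space_complete.

(** The modulus of a join is at most the sum of the moduli, so solidity applies. The factors [|1|]
    are those that [gaugeZ] produces. *)
Lemma gauge_join_ex w z : exists v, gauge_incl v = vjoin (gauge_incl w) (gauge_incl z).
Proof.
have [m wm] := gauge_inclP w; have [m' zm'] := gauge_inclP z.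
apply: (@gauge_incl_ex _ (`|1| * m + `|1| * m')).
apply: (gauge_solid (x := vabs (1 *: gauge_incl w) + vabs (1 *: gauge_incl z))).
  rewrite !scale1r; rewrite (ge0_vabs (x := _ + _)); last first.
    by rewrite -[0]addr0; apply: vle_lerD; exact: vabs_ge0.
  have := vabs_joinB (gauge_incl w) (gauge_incl z) 0 0.
  by rewrite (vjoin_r (x := 0) vle_refl) !subr0.
by apply: gaugeD; apply: (gauge_solid (x := 1 *: _)); rewrite ?vabs_id;
  [exact: vle_refl|exact: gaugeZ|exact: vle_refl|exact: gaugeZ].
Qed.

Definition gauge_join w z := projT1 (cid (gauge_join_ex w z)).

Lemma gauge_joinE w z :
  gauge_incl (gauge_join w z) = vjoin (gauge_incl w) (gauge_incl z).
Proof. exact: projT2 (cid (gauge_join_ex w z)). Qed.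

Definition gauge_meet w z := - gauge_join (- w) (- z).

Lemma gauge_meetE w z :
  gauge_incl (gauge_meet w z) = vmeet (gauge_incl w) (gauge_incl z).
Proof. by rewrite (linearN gauge_incl) gauge_joinE !(linearN gauge_incl) -vmeetE. Qed.

Definition gauge_vle w z := vle (gauge_incl w) (gauge_incl z).

Fact gauge_vle_refl w : gauge_vle w w. Proof. exact: vle_refl. Qed.

Fact gauge_vle_anti w z : gauge_vle w z -> gauge_vle z w -> w = z.
Proof. by move=> wz zw; apply: gauge_incl_inj; exact: vle_anti. Qed.

Fact gauge_vle_trans z w v : gauge_vle w z -> gauge_vle z v -> gauge_vle w v.
Proof. exact: vle_trans. Qed.

Fact gauge_vle_joinl w z : gauge_vle w (gauge_join w z).
Proof. by rewrite /gauge_vle gauge_joinE; exact: vle_joinl. Qed.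

Fact gauge_vle_joinr w z : gauge_vle z (gauge_join w z).
Proof. by rewrite /gauge_vle gauge_joinE; exact: vle_joinr. Qed.

Fact gauge_join_le w z v : gauge_vle w v -> gauge_vle z v -> gauge_vle (gauge_join w z) v.
Proof. by rewrite /gauge_vle gauge_joinE; exact: vjoin_le. Qed.

Fact gauge_meet_lel w z : gauge_vle (gauge_meet w z) w.
Proof. by rewrite /gauge_vle gauge_meetE; exact: vmeet_lel. Qed.

Fact gauge_meet_ler w z : gauge_vle (gauge_meet w z) z.
Proof. by rewrite /gauge_vle gauge_meetE; exact: vmeet_ler. Qed.

Fact gauge_le_meet w z v : gauge_vle v w -> gauge_vle v z -> gauge_vle v (gauge_meet w z).
Proof. by rewrite /gauge_vle gauge_meetE; exact: vle_meet. Qed.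

Fact gauge_vle_add w z v : gauge_vle w z -> gauge_vle (w + v) (z + v).
Proof. by rewrite /gauge_vle !(linearD gauge_incl); exact: vle_add. Qed.

Fact gauge_vle_scale (a : R) w z : 0 <= a -> gauge_vle w z -> gauge_vle (a *: w) (a *: z).
Proof. by rewrite /gauge_vle !(linearZ_LR gauge_incl); exact: vle_scale. Qed.

Fact gauge_norm_mono w z :
  gauge_vle (gauge_join w (- w)) (gauge_join z (- z)) -> `|w| <= `|z|.
Proof.
rewrite /gauge_vle !gauge_joinE !(linearN gauge_incl) => h.
by apply/gauge_normP; apply: gauge_solid h _; exact: gauge_norm_le.
Qed.

HB.instance Definition _ := isBanachLattice.Build R gauge_space
  gauge_vle_refl gauge_vle_anti gauge_vle_trans gauge_vle_joinl gauge_vle_joinr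
  gauge_join_le gauge_meet_lel gauge_meet_ler gauge_le_meet gauge_vle_add
  gauge_vle_scale gauge_norm_mono.

Lemma gauge_incl_hom : lattice_hom gauge_incl.
Proof. by split=> w z; [exact: gauge_joinE|exact: gauge_meetE]. Qed.

Lemma gauge_incl_positive : positive_op gauge_incl.
Proof. by move=> w; rewrite {1}/vle/= /gauge_vle (linear0 gauge_incl). Qed.

(** The span is an ideal of [E]: by solidity, whatever lies between 0 and a member belongs to it. *)
Lemma gauge_incl_interval : interval_preserving gauge_incl.
Proof.
split=> [|w w0]; first exact: gauge_incl_positive.
apply/seteqP; split=> [_ [z [z0 zw] <-]|x [x0 xw]].
  split; first exact: gauge_incl_positive.
  exact: zw.
have [m wm] := gauge_inclP w.
have [z zx] : exists z, gauge_incl z = x.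
  apply: (@gauge_incl_ex _ m); apply: gauge_solid wm; rewrite ge0_vabs//.
  exact: vle_trans (vle_abs _).
exists z => //; split; last by rewrite /vle/= /gauge_vle zx.
by rewrite /vle/= /gauge_vle (linear0 gauge_incl) zx.
Qed.

End gauge_space.

(** * Solid p-convex hulls *)

Section pconvex_hull.
Context {R : realType} {E : banachLatticeType R} (p : \bar R).
Hypothesis p1 : (1 <= p)%E.
Variable A : set E.

(* [z] lies in [m] times the solid p-convex hull of [A]. *)
Definition hull (z : E) (m : R) := exists n (c : 'rV[R]_n) (a : 'I_n -> E),
  [/\ forall j, 0 <= c ord0 j, forall j, A (a j), pnorm p c <= m
    & vle (vabs z) (psum p (fun j => c ord0 j *: a j))].

Lemma hull_ge0 z m : hull z m -> 0 <= m.
Proof. by move=> [n [c [a [_ _ + _]]]]; apply: le_trans; exact: pnorm_ge0. Qed.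

Lemma hull00 : hull 0 0.
Proof.
exists 0%N, 0, (fun=> 0); split=> [[]//|[]//||]; first by rewrite (homog_cont0 (pnorm_homog p1 0)).
by rewrite vabs0; exact: psum_ge0.
Qed.

Lemma hull_mono z m m' : m <= m' -> hull z m -> hull z m'.
Proof.
by move=> mm' [n [c [a [? ? h ?]]]]; exists n, c, a; split=> //; exact: le_trans mm'.
Qed.

Lemma hull_solid x y m : vle (vabs y) (vabs x) -> hull x m -> hull y m.
Proof.
by move=> yx [n [c [a [? ? ? h]]]]; exists n, c, a; split=> //; exact: vle_trans h.
Qed.

Lemma hull_gen a c : A a -> 0 <= c -> hull (c *: a) c.
Proof.
move=> Aa c0; exists 1%N, (const_mx c), (fun=> a); split=> //.
- by move=> j; rewrite mxE.
- by rewrite pnorm1// mxE ger0_norm.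
- by rewrite psum1// mxE; exact: vle_refl.
Qed.

Lemma hullZ (k : R) z m : hull z m -> hull (k *: z) (`|k| * m).
Proof.
move=> [n [c [a [c0 Aa cm za]]]]; exists n, (`|k| *: c), a; split=> //.
- by move=> j; rewrite mxE mulr_ge0.
- by rewrite pnormZ// ler_wpM2l.
- rewrite vabsZ (_ : (fun _ => _) = (fun j => `|k| *: (c ord0 j *: a j))).
    by rewrite psumZ//; exact: vle_scale.
  by apply/funext => j; rewrite mxE scalerA.
Qed.

(** The families representing the [z i] are concatenated: [pnorm_block] computes the norm of the
    joint coefficients and [psum_block] the joint p-sum. *)
Lemma hull_psum n (z : 'I_n -> E) (m : 'rV[R]_n) :
  (forall i, hull (z i) (m ord0 i)) -> hull (psum p z) (pnorm p m).
Proof.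
move=> zm.
have /choice[q hq] : forall i, exists q : {k : nat & ('rV[R]_k * ('I_k -> E))%type},
    [/\ forall j, 0 <= (projT2 q).1 ord0 j, forall j, A ((projT2 q).2 j),
      pnorm p (projT2 q).1 <= m ord0 i
      & vle (vabs (z i)) (psum p (fun j => (projT2 q).1 ord0 j *: (projT2 q).2 j))].
  by move=> i; have [k [c [a h]]] := zm i; exists (existT _ k (c, a)).
pose k i := projT1 (q i); pose c i := (projT2 (q i)).1; pose a i := (projT2 (q i)).2.
pose cc (u : {i : 'I_n & 'I_(k i)}) : R := c (tag u) ord0 (tagged u).
pose aa (u : {i : 'I_n & 'I_(k i)}) : E := a (tag u) (tagged u).
exists #|{: {i : 'I_n & 'I_(k i)}}|, (\row_l cc (enum_val l)), (fun l => aa (enum_val l)).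
split.
- by move=> l; rewrite mxE /cc; have [h _ _ _] := hq (tag (enum_val l)); exact: h.
- by move=> l; have [_ h _ _] := hq (tag (enum_val l)); exact: h.
- rewrite (pnorm_block p1 cc); apply: pnorm_mono => // i; rewrite mxE.
  have [_ _ h _] := hq i; rewrite ger0_norm ?pnorm_ge0//.
  rewrite (_ : \row_j _ = c i); first exact: le_trans h (ler_norm _).
  by apply/rowP => j; rewrite mxE.
- rewrite ge0_vabs; last exact: psum_ge0.
  rewrite (_ : (fun _ => _) =
    (fun l : 'I_#|{: {i : 'I_n & 'I_(k i)}}| => (fun u => cc u *: aa u) (enum_val l))).
    rewrite (psum_block p1 (fun u => cc u *: aa u)); apply: psum_mono => // i.
    have [_ _ _ h] := hq i; apply: (vle_trans _ h); exact: vle_abs.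
  by apply/funext => l; rewrite mxE.
Qed.

(** Factor the weights [m / (m + m')] and [m' / (m + m')] as [b j * s j]. The rescaled vectors
    [Z j / b j] have radii [(m + m') * s j], so their p-sum has radius [m + m']; as [b] is in the
    dual ball, this p-sum dominates [|x| + |y|]. Positive radii make [b] invertible. *)
Lemma hullD x y m m' : 0 < m -> 0 < m' -> hull x m -> hull y m' -> hull (x + y) (m + m').
Proof.
move=> m0 m'0 xm ym; have mm0 : 0 < m + m' by rewrite addr_gt0.
pose M (j : 'I_2) := if j == ord0 then m else m'.
pose Z (j : 'I_2) := if j == ord0 then x else y.
have M0 j : 0 < M j by rewrite /M; case: ifP.
have ZM j : hull (Z j) (M j) by rewrite /Z /M; case: ifP.
have [||b [s [bs s1 b0 s0 hb]]] := @pnorm_factor R p p1 2 (\row_j (M j / (m + m'))).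
- by move=> j; rewrite mxE divr_ge0// ltW.
- under eq_bigr do rewrite mxE.
  by rewrite big_ord_recl big_ord1 /M/= -mulrDl mulfV// gt_eqF.
have bp j : 0 < b ord0 j.
  rewrite lt_neqAle b0 andbT eq_sym; apply/negP => /eqP h.
  have := bs j; rewrite h mul0r mxE => /esym/eqP.
  by rewrite mulf_eq0 invr_eq0 !gt_eqF.
have : hull (psum p (fun j => (b ord0 j)^-1 *: Z j)) (pnorm p ((m + m') *: s)).
  apply: hull_psum => j; rewrite (_ : ((m + m') *: s) ord0 j = `|(b ord0 j)^-1| * M j).
    exact: hullZ.
  rewrite gtr0_norm ?invr_gt0// mxE.
  have := bs j; rewrite mxE => h; apply: (mulfI (x := b ord0 j)); first by rewrite gt_eqF.
  by rewrite [RHS]mulrA [X in _ = X * _]mulfV ?gt_eqF// mul1r mulrCA h mulrC mulfVK ?gt_eqF.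
rewrite pnormZ ?(ltW mm0)// s1 mulr1; apply: hull_solid.
rewrite (ge0_vabs (psum_ge0 _ _))//; apply: (vle_trans (vabs x + vabs y)).
  exact: vabsD.
have hb' : dual_ball p b.
  by move=> t; under eq_bigr do rewrite (ger0_norm (b0 _)); exact: hb.
have := psum_ge p1 (fun j => (b ord0 j)^-1 *: Z j) hb'; congr vle.
rewrite big_ord_recl big_ord1; congr (_ + _);
  by rewrite vabsZ scalerA ger0_norm// ger0_norm ?invr_ge0// mulfV ?gt_eqF// scale1r.
Qed.

Variable C : R.
Hypothesis C0 : 0 <= C.
Hypothesis A_bound : forall n (c : 'rV[R]_n) (a : 'I_n -> E),
  (forall j, 0 <= c ord0 j) -> (forall j, A (a j)) ->
  `|psum p (fun j => c ord0 j *: a j)| <= C * pnorm p c.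

Lemma hull_bound z m : hull z m -> `|z| <= C * m.
Proof.
move=> [n [c [a [c0 Aa cm za]]]]; apply: le_trans (vabs_le_norm za) _.
by apply: le_trans (A_bound c0 Aa) _; exact: ler_wpM2l.
Qed.

(** The tolerance affects the radius as well as the vector: this yields [chull_inf], and provides
    the positive radii that [hullD] asks for. *)
Definition chull (x : E) (m : R) := 0 <= m /\
  forall e : R, 0 < e -> exists2 z, `|x - z| <= e & hull z (m + e).

Lemma hull_chull x m : hull x m -> chull x m.
Proof.
move=> xm; split=> [|e e0]; first exact: hull_ge0 xm.
exists x; first by rewrite subrr normr0 ltW.
by apply: hull_mono xm; rewrite lerDl ltW.
Qed.

Lemma chull_ge0 x m : chull x m -> 0 <= m. Proof. by case. Qed.

Lemma chull_mono x m m' : m <= m' -> chull x m -> chull x m'.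
Proof.
move=> mm' [m0 h]; split=> [|e e0]; first exact: le_trans mm'.
by have [z xz zm] := h e e0; exists z => //; apply: hull_mono zm; rewrite lerD2r.
Qed.

Lemma chullD x y m m' : chull x m -> chull y m' -> chull (x + y) (m + m').
Proof.
move=> [m0 hx] [m'0 hy]; split=> [|e e0]; first exact: addr_ge0.
have e2 : 0 < e / 2 by rewrite divr_gt0.
have [z xz zm] := hx _ e2; have [z' yz z'm] := hy _ e2; exists (z + z').
  rewrite opprD addrACA [leRHS](splitr e); apply: le_trans (ler_normD _ _) _.
  exact: lerD.
rewrite [X in hull _ (_ + X)](splitr e) [X in hull _ X]addrACA.
by apply: hullD => //; rewrite ltr_wpDl.
Qed.

Lemma chull_inf x m : (forall e : R, 0 < e -> chull x (m + e)) -> chull x m.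
Proof.
move=> h; split=> [|e e0].
  by apply/ler_addgt0Pr => e e0; have [] := h e e0.
have e2 : 0 < e / 2 by rewrite divr_gt0.
have [_ /(_ _ e2)[z xz zm]] := h _ e2; exists z.
  by apply: le_trans xz _; lra.
by apply: hull_mono zm; lra.
Qed.

Lemma chullZ (k : R) x m : chull x m -> chull (k *: x) (`|k| * m).
Proof.
move=> [m0 h]; split=> [|e e0]; first exact: mulr_ge0.
have k0 : 0 < `|k| + 1 by rewrite ltr_wpDl.
have d0 : 0 < e / (`|k| + 1) by rewrite divr_gt0.
have [z xz zm] := h _ d0; exists (k *: z).
  rewrite -scalerBr normrZ; apply: le_trans (ler_wpM2l (normr_ge0 k) xz) _.
  by rewrite mulrCA ler_piMr ?(ltW e0)// ler_pdivrMr// mul1r lerDl.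
apply: hull_mono (hullZ k zm); rewrite mulrDr lerD2l.
by rewrite mulrCA ler_piMr ?(ltW e0)// ler_pdivrMr// mul1r lerDl.
Qed.

Lemma chull_closed x m :
  (forall e : R, 0 < e -> exists2 y, `|x - y| <= e & chull y m) -> chull x m.
Proof.
move=> h; split=> [|e e0]; first by have [y _ []] := h 1 ltr01.
have e2 : 0 < e / 2 by rewrite divr_gt0.
have [y xy [_ /(_ _ e2)[z yz zm]]] := h _ e2; exists z.
  rewrite -[x](subrK y) -addrA [leRHS](splitr e); apply: le_trans (ler_normD _ _) _.
  exact: lerD.
by apply: hull_mono zm; lra.
Qed.

(* Truncating [y] at level [|z|] moves it by at most [|x - z|]. *)
Lemma chull_solid x y m : vle (vabs y) (vabs x) -> chull x m -> chull y m.
Proof.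
move=> yx [m0 h]; split=> // e e0; have [z xz zm] := h e e0.
pose d := vabs (x - z); pose y' := vjoin (vmeet y (vabs z)) (- vabs z).
have xzd : vle (vabs x) (vabs z + d).
  by rewrite -{1}[x](subrK z) addrC; exact: vabsD.
have d0 : vle 0 d by exact: vabs_ge0.
have yxd : vle (vabs y) (vabs z + d) by exact: vle_trans xzd.
have /vabs_leP[yp yn] := yxd.
exists y'; last first.
  apply: hull_solid zm; apply/vabs_leP; split.
    apply/vjoinP; split; first exact: vmeet_ler.
    apply: (vle_trans 0); last exact: vabs_ge0.
    by apply: vle_oppl; rewrite oppr0; exact: vabs_ge0.
  by apply: vle_oppl; exact: vle_joinr.
apply: le_trans xz; rewrite -(vnorm_abs (x - z)) -/d.
apply: vabs_le_norm; apply/vabs_leP; split.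
  rewrite vle_subrR addrC -vle_subrR.
  apply: (vle_trans (vmeet y (vabs z))); last exact: vle_joinl.
  apply: vle_meet; last by rewrite vle_subrR.
  by rewrite vle_subrR -{1}[y]addr0; apply: vle_lerD => //; exact: vle_refl.
rewrite opprB vle_subrR; apply/vjoinP; split.
  apply: (vle_trans y); first exact: vmeet_lel.
  by rewrite -{1}[y]add0r; apply: vle_lerD => //; exact: vle_refl.
by apply: vle_oppl; rewrite opprD addrC vle_subrR; move: yn; rewrite -vle_subrR.
Qed.

Lemma chull_bound x m : chull x m -> `|x| <= C * m.
Proof.
move=> [m0 h]; apply/ler_addgt0Pr => e e0.
have k0 : 0 < 1 + C by rewrite ltr_wpDr.
have d0 : 0 < e / (1 + C) by rewrite divr_gt0.
have [z xz zm] := h _ d0; rewrite -[x](subrK z).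
apply: le_trans (ler_normD _ _) _; apply: le_trans (lerD xz (hull_bound zm)) _.
rewrite mulrDr addrCA lerD2l -[X in X + _]mul1r -mulrDl mulrC mulfVK// gt_eqF//.
Qed.

(** Transparent, so that [gauge_le hull_gauge] converts to [chull] in later proofs. *)
Definition hull_gauge : gauge E.
Proof.
apply: (@Gauge R E chull) => //.
- exact: chull_ge0.
- by apply: hull_chull; exact: hull00.
- exact: chull_mono.
- by move=> x y m m'; exact: chullD.
- exact: chullZ.
- exact: chull_inf.
- exact: chull_closed.
- exact: chull_solid.
- by exists C => //; exact: chull_bound.
Defined.

Lemma chull_psum n (z : 'I_n -> E) (m : 'rV[R]_n) :
  (forall i, chull (z i) (m ord0 i)) -> chull (psum p z) (pnorm p m).
Proof.
move=> zm; split=> [|e e0]; first exact: pnorm_ge0.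
have [B B0 hB] := @psum_dist R p p1 E n.
(* [B * n] accounts for replacing each [z i] by a vector at distance [d], the last term for
   enlarging every radius by [d]. *)
pose N := 1 + B * n%:R + pnorm p (const_mx 1 : 'rV[R]_n).
have P0 : 0 <= pnorm p (const_mx 1 : 'rV[R]_n) by exact: pnorm_ge0.
have Bn0 : 0 <= B * n%:R by rewrite mulr_ge0.
have N0 : 0 < N by rewrite /N; lra.
pose d := e / N; have d0 : 0 < d by rewrite divr_gt0.
have dE : d * N = e by rewrite mulfVK// gt_eqF.
have /choice[y hy] : forall i, exists y, `|z i - y| <= d /\ hull y (m ord0 i + d).
  by move=> i; have [_ /(_ d d0)[y ? ?]] := zm i; exists y.
exists (psum p y).
  apply: le_trans (hB _ _) _; apply: (@le_trans _ _ (B * (n%:R * d))).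
    apply: ler_wpM2l => //; rewrite mulr_natl -[X in _ *+ X]card_ord -sumr_const.
    by apply: ler_sum => i _; have [] := hy i.
  rewrite -dE mulrA mulrC ler_wpM2l ?(ltW d0)//; rewrite /N; lra.
have : hull (psum p y) (pnorm p (m + d *: const_mx 1)).
  by apply: hull_psum => i; rewrite !mxE mulr1; have [] := hy i.
apply: hull_mono; apply: le_trans (pnormD p1 _ _) _; rewrite lerD2l.
rewrite pnormZ ?(ltW d0)// -dE ler_wpM2l ?(ltW d0)//; rewrite /N; lra.
Qed.

Lemma hull_space_pconvex : pconvex_bound p (idmap (gauge_space hull_gauge)) 1.
Proof.
apply/pconvex_boundE => //; split=> // n v; rewrite mul1r gauge_normE.
apply/gauge_normP; rewrite psum_hom//; last exact: gauge_incl_hom.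
apply: chull_psum => i; rewrite mxE.
exact: (@gauge_norm_le _ _ hull_gauge (v i)).
Qed.

Lemma hull_space_opnorm (w : gauge_space hull_gauge) : `|gauge_incl hull_gauge w| <= C * `|w|.
Proof. by apply: chull_bound; exact: (@gauge_norm_le _ _ hull_gauge w). Qed.

End pconvex_hull.

(** * Factorization *)

Section positive_operators.
Context {R : realType} {W E : banachLatticeType R} (psi : {linear W -> E}).
Hypothesis psi0 : positive_op psi.

Lemma positive_op_le w z : vle w z -> vle (psi w) (psi z).
Proof.
by rewrite vle_subr0 => /psi0; rewrite (linearB psi) -vle_subr0.
Qed.

Lemma positive_op_abs w : `|psi w| <= `|psi (vabs w)|.
Proof.
apply: vabs_le_norm; apply/vabs_leP; split; first exact/positive_op_le/vle_abs.
by rewrite -(linearN psi); apply/positive_op_le/vle_absN.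
Qed.

(* Gliding hump: if [|psi w_k| > 4 ^ k] for unit vectors [w_k], then [psi] sends
   the sum of the [2 ^ - k |w_k|] above vectors of norm [2 ^ k]. *)
Lemma positive_op_bounded : exists M, forall w, `|w| <= 1 -> `|psi w| <= M.
Proof.
apply: contrapT => nb.
have /choice[w hw] : forall k : nat, exists w, `|w| <= 1 /\ 4 ^+ k < `|psi w|.
  move=> k; apply: contrapT => h; apply: nb; exists (4 ^+ k) => w w1.
  by rewrite leNgt; apply/negP => ?; apply: h; exists w.
pose u k := (2^-1 : R) ^+ k *: vabs (w k).
have u0 k : vle 0 (u k) by apply: vscale_ge0; [exact: exprn_ge0|exact: vabs_ge0].
have : cvgn (series u).
  apply: normed_cvg; apply: (@series_le_cvg _ _ (geometric 1 (2^-1 : R))).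
  - by move=> k /=.
  - by move=> k /=; rewrite mul1r exprn_ge0.
  - move=> k /=; rewrite normrZ mul1r ger0_norm ?exprn_ge0// vnorm_abs.
    by rewrite ler_piMr ?exprn_ge0//; have [] := hw k.
  - by apply: is_cvg_geometric_series; rewrite ger0_norm// invf_lt1// ltr1n.
move=> /cvg_ex[s us].
have uks k : vle (u k) s.
  apply: vle_closed => e e0.
  have /cvgrPdist_le/(_ e e0) [N _ hN] := us.
  have := hN (maxn N k.+1) (leq_maxl _ _) => /= h.
  exists (series u (maxn N k.+1) - s); first by rewrite distrC.
  rewrite addrC subrK /series/= big_mkord.
  have kM : (k < maxn N k.+1)%N by rewrite leq_max leqnn orbT.
  rewrite (bigD1 (Ordinal kM))//= -[X in vle X]addr0.
  apply: vle_lerD; first exact: vle_refl.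
  apply: (big_ind (vle 0)) => [|a b a0 b0|//]; first exact: vle_refl.
  by rewrite -[0]addr0; exact: vle_lerD.
have big k : 2 ^+ k < `|psi s| :> R.
  have [_ h] := hw k; have h4 := positive_op_abs (w k).
  have : `|psi (u k)| <= `|psi s|.
    by apply: vle_norm; [exact: psi0|exact: positive_op_le].
  rewrite /u (linearZ_LR psi) normrZ ger0_norm ?exprn_ge0//; apply: lt_le_trans.
  rewrite exprVn ltr_pdivlMl ?exprn_gt0// -exprMn.
  rewrite (_ : 2 * 2 = 4); last by ring.
  exact: lt_le_trans h h4.
have := big (Num.truncn `|psi s|).+1; rewrite ltNge => /negP; apply.
have : `|psi s| < (Num.truncn `|psi s|).+1%:R by rewrite truncnS_gt.
move=> /ltW/le_trans; apply; rewrite -natrX ler_nat.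
exact/ltnW/ltn_expl.
Qed.

Lemma opnorm_has_sup : has_sup [set `|psi w| | w in [set w : W | `|w| <= 1]].
Proof.
split; first by exists `|psi 0|, 0 => //=; rewrite normr0.
by have [M hM] := positive_op_bounded; exists M => _ [w w1 <-]; exact: hM.
Qed.

Lemma opnorm_ge0 : 0 <= opnorm psi.
Proof.
apply: (@le_trans _ _ `|psi 0|) => //; apply: sup_upper_bound => /=.
  exact: opnorm_has_sup.
by exists 0 => //=; rewrite normr0.
Qed.

Lemma opnormP w : `|psi w| <= opnorm psi * `|w|.
Proof.
have [->|w0] := eqVneq w 0; first by rewrite linear0 !normr0 mulr0.
have wp : 0 < `|w| by rewrite normr_gt0.
have : `|psi (`|w|^-1 *: w)| <= opnorm psi.
  apply: sup_upper_bound; first exact: opnorm_has_sup.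
  exists (`|w|^-1 *: w) => //=.
  by rewrite normrZ ger0_norm ?invr_ge0// mulVf// gt_eqF.
by rewrite (linearZ_LR psi) normrZ ger0_norm ?invr_ge0// ler_pdivrMl// mulrC.
Qed.

Lemma opnorm_le C : 0 <= C -> (forall w, `|psi w| <= C * `|w|) -> opnorm psi <= C.
Proof.
move=> C0 h; apply: ge_sup; first by case: opnorm_has_sup.
by move=> _ [w /= w1 <-]; apply: le_trans (h w) _; rewrite ler_piMr.
Qed.

End positive_operators.

(** * Attainment of the best constants *)

Section best_constants.
Context {R : realType}.

Lemma le_mul_eps (a b M : R) : 0 <= b ->
  (forall e, 0 < e -> a <= (M + e) * b) -> a <= M * b.
Proof.
move=> b0 h; apply/ler_addgt0Pr => d d0.
have b1 : 0 < b + 1 by rewrite ltr_wpDl.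
apply: le_trans (h (d / (b + 1)) _) _; first by rewrite divr_gt0.
rewrite mulrDl lerD2l -mulrA ler_piMr ?(ltW d0)// mulrC ler_pdivrMr//.
by rewrite mul1r lerDl.
Qed.

(** The common reason why the Lipschitz, p-convexity and Lipschitz p-convexity constants are
    themselves admissible. *)
Lemma inf_in (S : set R) : S !=set0 -> (forall M, S M -> 0 <= M) ->
  (forall M M', M <= M' -> S M -> S M') ->
  (forall M, 0 <= M -> (forall e, 0 < e -> S (M + e)) -> S M) -> S (inf S).
Proof.
move=> S0 Sge Sup Scl; apply: Scl => [|e e0]; first exact: lb_le_inf.
have : inf S < inf S + e by rewrite ltrDl.
by move=> /(inf_lt S0)[M SM /ltW Me]; exact: Sup SM.
Qed.

Lemma lip_constP (X : metricType R) (E : normedModType R) (f : X -> E) :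
  lipschitz_map f -> lip_bound f (lip_const f).
Proof.
move=> f_lip; apply: inf_in => //.
- by move=> M [].
- move=> M M' MM' [M0 h]; split; first exact: le_trans MM'.
  by move=> x y; apply: le_trans (h x y) _; rewrite ler_wpM2r// mdist_ge0.
- move=> M M0 h; split=> // x y; apply: le_mul_eps; first exact: mdist_ge0.
  by move=> e /h[_].
Qed.

Lemma pconvex_constP (p : \bar R) (W : banachLatticeType R) : (1 <= p)%E ->
  pconvex_lattice p W -> pconvex_bound p (idmap W) (pconvex_const p (idmap W)).
Proof.
move=> p1 Wp; apply: inf_in.
- exact: Wp.
- by move=> M [].
- move=> M M' MM' /(pconvex_boundE _ _ p1)[M0 h]; apply/(pconvex_boundE _ _ p1).
  split; first exact: le_trans MM'.
  by move=> n v; apply: le_trans (h n v) _; rewrite ler_wpM2r// pnorm_ge0.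
- move=> M M0 h; apply/(pconvex_boundE _ _ p1); split=> [//|n v].
  apply: le_mul_eps; first exact: pnorm_ge0.
  by move=> e /h/(pconvex_boundE _ _ p1)[_].
Qed.

Lemma lip_pconvex_constP (p : \bar R) (X : metricType R) (E : banachLatticeType R)
    (T : X -> E) : (1 <= p)%E ->
  lip_pconvex p T -> lip_pconvex_bound p T (lip_pconvex_const p T).
Proof.
move=> p1 Tp; apply: inf_in.
- exact: Tp.
- by move=> M [].
- move=> M M' MM' /(lip_pconvex_boundE _ _ p1)[M0 h]; apply/(lip_pconvex_boundE _ _ p1).
  split; first exact: le_trans MM'.
  by move=> n x x' c c0; apply: le_trans (h n x x' c c0) _; rewrite ler_wpM2r// pnorm_ge0.
- move=> M M0 h; apply/(lip_pconvex_boundE _ _ p1); split=> [//|n x x' c c0].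
  apply: le_mul_eps; first exact: pnorm_ge0.
  by move=> e /h/(lip_pconvex_boundE _ _ p1)[_ hh]; exact: hh.
Qed.

End best_constants.

Lemma factorization_bound (R : realType) (X : metricType R)
    (E W : banachLatticeType R) (p : \bar R) (T : X -> E)
    (psi : {linear W -> E}) (rho : X -> W) : (1 <= p)%E ->
  pconvex_factorization p T psi rho ->
  lip_pconvex_bound p T (lip_const rho * pconvex_const p (idmap W) * opnorm psi).
Proof.
move=> p1 [Wp psi0 rho_lip ->]; apply/(lip_pconvex_boundE _ _ p1).
have [L0 hL] := lip_constP rho_lip.
have /(pconvex_boundE _ _ p1)[M0 hM] := pconvex_constP p1 Wp.
set L := lip_const rho in L0 hL *; set M := pconvex_const _ _ in M0 hM *.
have N0 := opnorm_ge0 psi0; split; first by rewrite !mulr_ge0.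
move=> n x x' c c0; pose v j := c j *: (rho (x j) - rho (x' j)).
rewrite (_ : (fun j => _) = (fun j => psi (v j))); last first.
  by apply/funext => j; rewrite /v (linearZ_LR psi) (linearB psi).
apply: le_trans (vle_norm (psum_ge0 p1 _) (psum_positive p1 v psi0)) _.
apply: le_trans (opnormP psi0 _) _.
rewrite [leRHS]mulrAC [leRHS]mulrC; apply: ler_wpM2l => //.
apply: le_trans (hM n v) _; rewrite [leRHS]mulrAC [leRHS]mulrC; apply: ler_wpM2l => //.
rewrite -(pnormZ p1)//; apply: pnorm_mono => // j; rewrite !mxE normr_id.
rewrite normrZ (ger0_norm (c0 j)) ger0_norm; last by rewrite !mulr_ge0 ?mdist_ge0.
by rewrite mulrCA ler_wpM2l.
Qed.

(** * The factorization of a Lipschitz p-convex map *)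

Section construction.
Context {R : realType} {X : metricType R} {E : banachLatticeType R}.
Variables (p : \bar R) (T : X -> E).
Hypothesis p1 : (1 <= p)%E.

(* Slopes of [T], enlarged by the segment [-e, e]: without the segment, the
   lattice generated by the slopes would contain the differences of values of
   [T] but not the values themselves. *)
Definition slopes (e : E) : set E := [set a | exists x x' (k : R),
  `|k| <= 1 /\ a = (mdist x x')^-1 *: (T x - T x') + k *: e].

(** Dividing each coefficient by the distance gives weights for the Lipschitz p-convexity of [T],
    whose right-hand side is then at most [C * pnorm p c]; the segment adds [|e|]. *)
Lemma slopes_bound (e : E) C : lip_pconvex_bound p T C ->
  forall n (c : 'rV[R]_n) (a : 'I_n -> E),
  (forall j, 0 <= c ord0 j) -> (forall j, slopes e (a j)) ->
  `|psum p (fun j => c ord0 j *: a j)| <= (C + `|e|) * pnorm p c.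
Proof.
move=> /(lip_pconvex_boundE _ _ p1)[C0 hC] n c a c0 ha.
have /choice[q hq] : forall j, exists q : X * X * R, `|q.2| <= 1 /\
    a j = (mdist q.1.1 q.1.2)^-1 *: (T q.1.1 - T q.1.2) + q.2 *: e.
  by move=> j; have [x [x' [k h]]] := ha j; exists (x, x', k).
pose d j := mdist (q j).1.1 (q j).1.2.
have d0 j : 0 <= d j by exact: mdist_ge0.
rewrite (_ : (fun j => _) = (fun j =>
    (c ord0 j * (d j)^-1) *: (T (q j).1.1 - T (q j).1.2) +
    (\row_j (c ord0 j * (q j).2)) ord0 j *: e)); last first.
  by apply/funext => j; rewrite mxE (hq j).2 scalerDr !scalerA.
apply: le_trans (vle_norm (psum_ge0 p1 _) (psumD p1 _ _)) _.
apply: le_trans (ler_normD _ _) _; rewrite mulrDl; apply: lerD.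
  apply: le_trans (hC n _ _ _ _) _; first by move=> j; rewrite mulr_ge0 ?invr_ge0.
  apply: ler_wpM2l => //; apply: pnorm_mono => // j; rewrite mxE -/(d j).
  (* At distance 0 the weight times the distance vanishes; otherwise it cancels to [c ord0 j]. *)
  have [->|dn0] := eqVneq (d j) 0; first by rewrite mulr0 normr0.
  by rewrite mulfVK.
apply: le_trans (psum_scalar p1 _ _) _; rewrite mulrC; apply: ler_wpM2l => //.
apply: pnorm_mono => // j; rewrite mxE normrM ler_piMr//.
exact: (hq j).1.
Qed.

Lemma factorization_ex C (e : R) : lip_pconvex_bound p T C -> 0 < e ->
  exists (W : banachLatticeType R) (psi : {linear W -> E}) (rho : X -> W),
    [/\ pconvex_factorization p T psi rho, injective psi,
        interval_preserving psi, lattice_hom psi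
      & lip_const rho * pconvex_const p (idmap W) * opnorm psi <= C + e].
Proof.
move=> TC e0.
(* One value of [T], or 0 when [X] is empty. *)
have [v hv] : exists v, forall x0 : X, exists x, T x = v.
  have [[x _]|nX] := pselect (exists x : X, True); first by exists (T x) => _; exists x.
  by exists 0 => x; case: nX; exists x.
have v1 : 0 < 1 + `|v| by rewrite ltr_wpDr.
(* Scaled so that the perturbation [t *: v] has norm at most [e], the loss allowed in the
   conclusion. *)
pose t := e / (1 + `|v|); have t0 : 0 < t by rewrite divr_gt0.
have Ce0 : 0 <= C + `|t *: v| by rewrite addr_ge0//; have [] := TC.
pose g := hull_gauge p1 Ce0 (slopes_bound (e := t *: v) TC).
have gdiff x x' : gauge_le g (T x - T x') (mdist x x').
  apply: hull_chull => //; have [xx'|dn0] := eqVneq (mdist x x') 0.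
    by rewrite xx' (mdist_positivity _ _ xx') subrr; exact: hull00.
  rewrite (_ : T x - T x' = mdist x x' *: ((mdist x x')^-1 *: (T x - T x'))); last first.
    by rewrite scalerA mulfV// scale1r.
  apply: hull_gen => //; last exact: mdist_ge0.
  by exists x, x', 0; rewrite normr0 scale0r addr0.
(* [T x] is a difference of values plus [v], and [v] is a multiple of [t *: v], the slope with equal
   points and [k = 1]. *)
have gT x : exists m, gauge_le g (T x) m.
  have [y Ty] := hv x; exists (mdist x y + t^-1); rewrite -[T x](subrK (T y)).
  apply: gaugeD; first exact: gdiff.
  apply: hull_chull => //; rewrite (_ : T y = t^-1 *: (t *: v)); last first.
    by rewrite Ty scalerA mulVf ?gt_eqF// scale1r.
  apply: hull_gen => //; last by rewrite invr_ge0 ltW.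
  by exists y, y, 1; rewrite normr1 subrr scaler0 add0r scale1r.
have /choice[rho rhoT] : forall x, exists w, gauge_incl g w = T x.
  by move=> x; have [m xm] := gT x; exact: gauge_incl_ex xm.
have rho1 : lip_bound rho 1.
  split=> // x x'; rewrite mul1r gauge_normE; apply/gauge_normP.
  by rewrite (linearB (gauge_incl g)) !rhoT; exact: gdiff.
have W1 : pconvex_bound p (idmap (gauge_space g)) 1 by exact: hull_space_pconvex.
have psi0 := @gauge_incl_positive _ _ g.
have fac : pconvex_factorization p T (gauge_incl g) rho.
  split=> //; [by exists 1|by exists 1|].
  by apply/funext => x /=; rewrite -rhoT.
exists (gauge_space g), (gauge_incl g), rho; split; [exact: fac|exact: gauge_incl_inj
  |exact: gauge_incl_interval|exact: gauge_incl_hom|].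
have [_ _ /lip_constP[L0 _] _] := fac.
have [M0 _] : pconvex_bound p (idmap (gauge_space g)) (pconvex_const p (idmap (gauge_space g))).
  by apply: pconvex_constP => //; exists 1.
have L1 : lip_const rho <= 1 by apply: ge_inf => //; exists 0 => ? [].
have M1 : pconvex_const p (idmap (gauge_space g)) <= 1.
  by apply: ge_inf => //; exists 0 => ? [].
apply: (@le_trans _ _ (1 * opnorm (gauge_incl g))).
  by rewrite ler_wpM2r ?opnorm_ge0// mulr_ile1.
rewrite mul1r; apply: (@le_trans _ _ (C + `|t *: v|)).
  by apply: opnorm_le => // w; exact: hull_space_opnorm.
rewrite lerD2l normrZ gtr0_norm// /t mulrAC ler_pdivrMr// ler_wpM2l ?(ltW e0)//.
by rewrite lerDr.
Qed.

End construction.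

Theorem theorem5p1 (R : realType) (E : banachLatticeType R)
    (X : metricType R) (p : \bar R) (T : X -> E) :
  (1 <= p)%E -> lipschitz_map T ->
  [/\ lip_pconvex p T <->
        (exists (W : banachLatticeType R) (psi : {linear W -> E})
            (rho : X -> W),
          pconvex_factorization p T psi rho),
      lip_pconvex p T ->
        (exists (W : banachLatticeType R) (psi : {linear W -> E})
            (rho : X -> W),
          [/\ pconvex_factorization p T psi rho, injective psi,
              interval_preserving psi & lattice_hom psi])
    & lip_pconvex p T ->
        lip_pconvex_const p T =
          inf [set c | exists (W : banachLatticeType R)
                         (psi : {linear W -> E}) (rho : X -> W),
                 pconvex_factorization p T psi rho /\
                 c = lip_const rho * pconvex_const p (idmap W) * opnorm psi]].
Proof.
move=> p1 _; split.
- split=> [[C TC]|[W [psi [rho fac]]]]; last first.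
    by eexists; exact: factorization_bound fac.
  have [W [psi [rho [fac _ _ _ _]]]] := factorization_ex p1 TC ltr01.
  by exists W, psi, rho.
- move=> [C TC]; have [W [psi [rho [fac inj ip lh _]]]] := factorization_ex p1 TC ltr01.
  by exists W, psi, rho.
- move=> Tp; have TC := lip_pconvex_constP p1 Tp; set F := [set c | _].
  have Flb c : F c -> lip_pconvex_const p T <= c.
    move=> [W [psi [rho [fac ->]]]]; apply: ge_inf; last exact: factorization_bound fac.
    by exists 0 => ? [].
  (* The construction is applied to the best constant, which is admissible, and repeated for every
     loss [e]. *)
  have F_small e : 0 < e -> exists2 c, F c & c <= lip_pconvex_const p T + e.
    move=> e0; have [W [psi [rho [fac _ _ _ h]]]] := factorization_ex p1 TC e0.
    by eexists; [exists W, psi, rho; split; [exact: fac|reflexivity]|exact: h].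
  apply/eqP; rewrite eq_le; apply/andP; split.
    by apply: lb_le_inf => //; have [c Fc _] := F_small _ ltr01; exists c.
  apply/ler_addgt0Pr => e e0; have [c Fc h] := F_small _ e0.
  by apply: le_trans h; apply: ge_inf => //; exists (lip_pconvex_const p T).
Qed.
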